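(* Let $0\le \ell_1,\ell_2<1$ with $\ell_1+\ell_2>0$, let $\phi^0\in H_0^1(I_{t_0})$ and $\phi^1\in L^2(I_{t_0})$, and let $\phi$ be the solution of (WP) with these initial data. Then $$tE(t)+\int_{-\ell_1t}^{\ell_2t}x\,\phi_x\phi_t\,dx=S_\ell\qquad\text{for all } t\ge t_0,$$ where $S_\ell:=2\pi^2\kappa_\ell\sum_{n\in\mathbb{Z}\setminus\{0\}}|nc_n|^2$, and $$\frac{S_\ell}{t(1+L)}\le E(t)\le\frac{S_\ell}{t(1-L)}\qquad\text{for all } t\ge t_0.$$
   Context: Let $L_0>0$, $t_0=L_0/(\ell_1+\ell_2)$, and $I_t=(-\ell_1t,\ell_2t)$ for $t\ge t_0$. All initial data and solutions are real-valued. Problem (WP) is the wave equation $$\phi_{tt}-\phi_{xx}=0 \text{ for } x\in I_t,\ t>t_0,\qquad \phi(-\ell_1t,t)=\phi(\ell_2t,t)=0 \text{ for } t>t_0,\qquad \phi(\cdot,t_0)=\phi^0,\ \phi_t(\cdot,t_0)=\phi^1 \text{ in } I_{t_0}.$$ For $\phi^0\in H^1_0(I_{t_0})$, $\phi^1\in L^2(I_{t_0})$ it has a unique solution with $\phi(\cdot,t)\in H_0^1(I_t)$, $\phi_t(\cdot,t)\in L^2(I_t)$ depending continuously on $t\ge t_0$. Its energy is $E(t)=\frac12\int_{-\ell_1t}^{\ell_2t}\left(\phi_x^2(x,t)+\phi_t^2(x,t)\right)dx$. Constants: $L=\max\{\ell_1,\ell_2\}$, $\alpha_\ell=\frac{1+\ell_1}{1-\ell_2}$,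 $\beta_\ell=\frac{1+\ell_2}{1-\ell_1}$, $\kappa_\ell=\frac{2}{\log(\alpha_\ell\beta_\ell)}$. The $c_n\in\mathbb{C}$, $n\in\mathbb{Z}\setminus\{0\}$, are the coefficients (independent of $t$) in the series representation of the solution $$\phi(x,t)=\sum_{n\in\mathbb{Z}\setminus\{0\}}c_n\left(e^{in\pi\kappa_\ell\log(t+x)}-e^{in\pi\kappa_\ell\log\left(\frac{1+\ell_2}{1-\ell_2}\right)}e^{in\pi\kappa_\ell\log(t-x)}\right),\qquad x\in I_t,\ t\ge t_0,$$ for which $\sum_{n}|nc_n|^2<\infty$. *)

(* Defs.v *)
From HB Require Import structures.
From mathcomp Require Import all_boot all_order all_algebra.
From mathcomp Require Import all_classical all_reals all_analysis.
From mathcomp Require Import complex.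

Set Implicit Arguments.
Unset Strict Implicit.
Unset Printing Implicit Defensive.

Import Order.TTheory GRing.Theory Num.Theory.
Import numFieldNormedType.Exports.

Local Open Scope classical_set_scope.
Local Open Scope ring_scope.

Section sobolev.
Context {R : realType}.
Implicit Types (A : set R) (u v w : R -> R).

(* [u \_ A] is [u] on [A], extended by 0. *)
Definition L2 A u : Prop :=
  (u \_ A : measurableTypeR R -> R) \in Lfun (@lebesgue_measure R) 2%:E.

Definition L2norm A u : \bar R :=
  ('N[ @lebesgue_measure R ]_ 2%:E [ EFin \o (u \_ A) ])%E.

Definition test_function A w : Prop :=
  (forall n x, derivable (derive1n n w) x 1) /\
  exists K : set R, [/\ compact K, K `<=` A & forall x, ~ K x -> w x = 0].

(* [u] is in H^1(A), with weak derivative [v] *)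
Definition H1 A u v : Prop :=
  [/\ L2 A u, L2 A v &
      forall w, test_function A w ->
        \int[@lebesgue_measure R]_(x in A) (u x * derive1 w x) =
        - \int[@lebesgue_measure R]_(x in A) (v x * w x)].

(* [u] is in H^1_0(A), the closure of the test functions in H^1(A), and [v] is
   its weak derivative *)
Definition H10_deriv A u v : Prop :=
  H1 A u v /\
  exists w : (R -> R)^nat,
    [/\ forall k, test_function A (w k),
        L2norm A (w k \- u) @[k --> \oo] --> 0%E &
        L2norm A (derive1 (w k) \- v) @[k --> \oo] --> 0%E].

Definition H10 A u : Prop := exists v, H10_deriv A u v.

End sobolev.

Section test_functions2.
Context {R : realType}.
Implicit Types f : R * R -> R.

(* Points of the plane are pairs (x, t). *)
Definition dx f : R * R -> R := fun z => 'D_((1, 0) : R * R) f z.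
Definition dt f : R * R -> R := fun z => 'D_((0, 1) : R * R) f z.

Fixpoint Ck (k : nat) f : Prop :=
  continuous f /\
  if k is k'.+1 then
    [/\ forall z, derivable f z ((1, 0) : R * R),
        forall z, derivable f z ((0, 1) : R * R),
        Ck k' (dx f) & Ck k' (dt f)]
  else True.

Definition test_function2 (Q : set (R * R)) f : Prop :=
  (forall k, Ck k f) /\
  exists K : set (R * R), [/\ compact K, K `<=` Q & forall z, ~ K z -> f z = 0].

End test_functions2.

Section wave.
Context {R : realType}.
Variables (l1 l2 t0 : R).
Implicit Types (u phi phix phit : R -> R -> R) (t x : R).

Definition Iat t : set R := `](- (l1 * t)), (l2 * t)[%classic.

Definition Qdom : set (R * R) := [set z | t0 < z.2 /\ Iat z.2 z.1].

(* [u(., t)] on [Iat t], extended by 0 to the whole line: the intervals depend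
   on [t], and continuity and differentiability in time with values in L^2
   are those of the extended functions. *)
Definition ext u t : R -> R := (u ^~ t) \_ (Iat t).

Definition L2_continuous u : Prop :=
  forall t, t0 <= t ->
    L2norm setT (ext u s \- ext u t) @[s --> within `[t0, +oo[ (nbhs t)]
      --> 0%E.

(* At [t0] the difference quotient is one-sided. *)
Definition L2_time_derivative u u' : Prop :=
  forall t, t0 <= t ->
    L2norm setT
      (fun x => (s - t)^-1 * (ext u s x - ext u t x) - ext u' t x)
      @[s --> within `[t0, +oo[ t^'] --> 0%E.

(* [phix] and [phit] are the derivatives of the solution [phi]; they are
   determined by [phi] up to null sets, for each time. The boundary condition
   is membership in H^1_0; the equation holds in the sense of distributions
   in the space-time domain. *)
Record WP_solution (phi0 phi1 : R -> R) phi phix phit : Prop := {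
  WP_H10 : forall t, t0 <= t -> H10_deriv (Iat t) (phi ^~ t) (phix ^~ t);
  WP_L2 : forall t, t0 <= t -> L2 (Iat t) (phit ^~ t);
  WP_cont : L2_continuous phi;
  WP_cont_x : L2_continuous phix;
  WP_cont_t : L2_continuous phit;
  WP_phit : L2_time_derivative phi phit;
  WP_wave : forall f, test_function2 Qdom f ->
    \int[@lebesgue_measure R]_(t in `]t0, +oo[)
      (\int[@lebesgue_measure R]_(x in Iat t)
         (phi x t * (dt (dt f) (x, t) - dx (dx f) (x, t)))) = 0;
  WP_init0 : {ae @lebesgue_measure R,
                forall x, Iat t0 x -> phi x t0 = phi0 x};
  WP_init1 : {ae @lebesgue_measure R,
                forall x, Iat t0 x -> phit x t0 = phi1 x} }.

Definition energy phix phit t : R :=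
  2^-1 * \int[@lebesgue_measure R]_(x in Iat t) (phix x t ^+ 2 + phit x t ^+ 2).

Definition alpha_l : R := (1 + l1) / (1 - l2).
Definition beta_l : R := (1 + l2) / (1 - l1).
Definition kappa_l : R := 2 / ln (alpha_l * beta_l).
Definition L_l : R := Num.max l1 l2.

Definition cis (y : R) : R[i] := (cos y +i* sin y)%C.

Definition mode (c : int -> R[i]) x t (n : int) : R[i] :=
  c n * (cis (n%:~R * pi * kappa_l * ln (t + x))
         - cis (n%:~R * pi * kappa_l * ln ((1 + l2) / (1 - l2)))
           * cis (n%:~R * pi * kappa_l * ln (t - x))).

Definition partial_sum (c : int -> R[i]) x t (N : nat) : R[i] :=
  \sum_(1 <= k < N.+1) (mode c x t k%:Z + mode c x t (- k%:Z)).

(* The modulus of a complex number is [`|z| : R[i]], a real element of R[i]. *)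
Definition sum_ncn2 (c : int -> R[i]) : \bar R :=
  \esum_(n in [set n : int | n != 0])
    ((complex.Re `|n%:~R * c n| ^+ 2)%:E).

(* Summability of [|n c_n|^2] makes the series over the nonzero integers
   absolutely convergent, so that the limit of its symmetric partial sums is
   its sum; the convergence in R[i] is that of real and imaginary parts. *)
Definition series_coefficients phi (c : int -> R[i]) : Prop :=
  (sum_ncn2 c < +oo)%E /\
  forall t, t0 <= t -> {ae @lebesgue_measure R, forall x, Iat t x ->
    complex.Re (partial_sum c x t N) @[N --> \oo] --> phi x t /\
    complex.Im (partial_sum c x t N) @[N --> \oo] --> (0 : R)}.

Definition S_l (c : int -> R[i]) : R :=
  2 * pi ^+ 2 * kappa_l * fine (sum_ncn2 c).

End wave.

(* Main.v *)
(** The series says [phi (x, t) = f (ln (t + x)) - f (delay + ln (t - x))] with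
    [f] a trigonometric series of period [P = ln (alpha_l * beta_l)].  For such
    a [phi] with [f] smooth, the integrand of [t E (t) + \int x phi_x phi_t] is
    the x-derivative of [G (ln (t + x)) - G (delay + ln (t - x))], where
    [G' = (f')^2]; as [x] runs through the moving interval, the two logarithms
    together sweep exactly one period, so the quantity equals
    [G (y + P) - G y], which is [S_l] by Parseval.

    To reach the actual solution, this is applied to the partial sums: the
    identity for their differences, together with Parseval, bounds the
    derivatives of the remainders in L^2, uniformly in time.  The limits are
    identified without completeness or density theorems: the weak
    x-derivative is tested against [w_k' - phi_N,x], where the test functions
    [w_k] come from the membership of [phi] in H^1_0, and the time derivative
    is compared with one-sided difference quotients, whose L^2 norms are
    controlled by the monotonicity of [G]. *)

Require Import Defs.
From HB Require Import structures.
From mathcomp Require Import all_boot all_order all_algebra.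
From mathcomp Require Import all_classical all_reals all_analysis.
From mathcomp Require Import complex.
From mathcomp Require Import measurable_realfun ring lra.
Import Order.TTheory GRing.Theory Num.Theory.
Import numFieldNormedType.Exports.
Local Open Scope classical_set_scope.
Local Open Scope ring_scope.

Set Implicit Arguments.
Unset Strict Implicit.
Unset Printing Implicit Defensive.

(** * Square integrable functions *)

(** The period comes from the geometry of the boundary. The delay makes the two logarithms agree at
    [x = l2 t], and at [x = - l1 t] they differ by exactly [P]; in between, they differ by at most
    [P]. So a periodic profile yields zero boundary values. As [G] is nondecreasing, its increment
    over a window of length at most [P] is at most the energy [e] of one period. Cauchy-Schwarz then
    gives [(f y - f x)^2 <= e (y - x)], a sup bound on the wave that depends on the profile only
    through [e]. With it, dominated convergence turns the almost everywhere convergence of the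
    series into convergence in L^2. The derivatives [phix] and [phit] are known only as L^2 limits,
    so the series cannot be differentiated term by term. The estimates on remainders must therefore
    use the energy alone: for the block of modes between [N] and [M] they are then small uniformly
    in [M]. No symmetry between [c n] and [c (- n)] is assumed. The real and imaginary parts are
    thus two separate real trigonometric series, to which the same limit theorem is applied. *)

Lemma sqr_bound_cvg0 (R : realType) (u v : R^nat) :
  (forall n, u n ^+ 2 <= v n) -> v @ \oo --> 0 -> u @ \oo --> 0.
Proof.
move=> uv v0; apply/cvgr0Pnorm_lt => e e0.
have e20 : 0 < e ^+ 2 by rewrite exprn_gt0.
move/cvgr0Pnorm_lt : v0 => /(_ _ e20).
apply: filterS => n; rewrite ltr_norml => /andP[_ vn].
rewrite -(ltr_pXn2r (n := 2)) ?nnegrE// ?(ltW e0)// real_normK ?num_real//.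
by rewrite (le_lt_trans (uv n)).
Qed.

Section square_integrable.
Context d (T : measurableType d) (R : realType).
Variables (mu : {measure set T -> \bar R}) (D : set T).
Hypothesis mD : measurable D.
Implicit Types u v : T -> R.

(** Stated on [D] itself, without extension by zero, so that continuous functions on a segment and
    restrictions to smaller intervals are handled directly. *)
Definition sqintegrable u : Prop :=
  measurable_fun D u /\ mu.-integrable D (EFin \o (fun x => u x ^+ 2)).

Definition ip u v : R := \int[mu]_(x in D) (u x * v x).

Lemma ipC u v : ip u v = ip v u.
Proof. by apply: eq_Rintegral => x _; rewrite mulrC. Qed.

Lemma ip_ge0 u : 0 <= ip u u.
Proof. by apply: Rintegral_ge0 => x _; rewrite -expr2 sqr_ge0. Qed.

Lemma eq_ip u u' v v' : (forall x, D x -> u x = u' x) ->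
  (forall x, D x -> v x = v' x) -> ip u v = ip u' v'.
Proof.
by move=> uu vv; apply: eq_Rintegral => x; rewrite inE => Dx; rewrite uu// vv.
Qed.

Lemma eq_sqintegrable u u' : (forall x, D x -> u x = u' x) ->
  sqintegrable u -> sqintegrable u'.
Proof.
move=> uu [mu1 iu]; split.
  by apply: eq_measurable_fun mu1 => x; rewrite inE => Dx; rewrite uu.
by apply: eq_integrable iu => // x; rewrite inE => Dx /=; rewrite uu.
Qed.

Lemma integrableM u v : sqintegrable u -> sqintegrable v ->
  mu.-integrable D (EFin \o (fun x => u x * v x)).
Proof.
move=> [mfu iu] [mfv iv].
apply: (@le_integrable _ _ _ mu D _ _
  ((EFin \o (fun x => u x ^+ 2)%R) \+ (EFin \o (fun x => v x ^+ 2)%R))%E) => //.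
- by apply/measurable_EFinP; exact: measurable_funM.
- move=> x _ /=; rewrite lee_fin [leRHS]ger0_norm; last by rewrite addr_ge0 ?sqr_ge0.
  by rewrite ler_norml; apply/andP; split; nra.
- exact: integrableD.
Qed.

Lemma sqintegrableZ (k : R) u : sqintegrable u -> sqintegrable (fun x => k * u x).
Proof.
move=> [mfu iu]; split; first exact: measurable_funM.
have : mu.-integrable D (fun x => ((k ^+ 2)%:E * (u x ^+ 2)%:E)%E).
  exact: integrableZl.
by apply: eq_integrable => // x _ /=; rewrite -EFinM exprMn.
Qed.

Lemma sqintegrableD u v : sqintegrable u -> sqintegrable v ->
  sqintegrable (fun x => u x + v x).
Proof.
move=> lu lv; have iuv := integrableM lu lv.
case: lu lv => [mfu iu] [mfv iv]; split; first exact: measurable_funD.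
have : mu.-integrable D ((EFin \o (fun x => u x ^+ 2)%R) \+
   ((EFin \o (fun x => v x ^+ 2)%R) \+
   ((fun x => 2%:E * (EFin \o (fun x => u x * v x)%R) x))))%E.
  apply: integrableD => //; apply: integrableD => //.
  exact: integrableZl.
by apply: eq_integrable => // x _ /=; rewrite -EFinM -!EFinD; congr EFin; ring.
Qed.

Lemma sqintegrableN u : sqintegrable u -> sqintegrable (fun x => - u x).
Proof.
by move/(sqintegrableZ (-1)); apply: eq_sqintegrable => x _; rewrite mulN1r.
Qed.

Lemma sqintegrableB u v : sqintegrable u -> sqintegrable v ->
  sqintegrable (fun x => u x - v x).
Proof. by move=> lu /sqintegrableN; exact: sqintegrableD. Qed.

Lemma sqintegrable_bounded u (C : R) : (mu D < +oo)%E ->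
  measurable_fun D u -> (forall x, D x -> `|u x| <= C) -> sqintegrable u.
Proof.
move=> muD mfu uC; split => //.
apply: measurable_bounded_integrable => //; first exact: measurable_funX.
exists (C ^+ 2); split; first exact: num_real.
move=> M CM x Dx /=; rewrite normrX; apply: le_trans (ltW CM).
rewrite ler_pXn2r// ?nnegrE//.
  exact: uC.
exact: le_trans (normr_ge0 _) (uC _ Dx).
Qed.

Lemma sqintegrableM (m u : T -> R) (C : R) : measurable_fun D m ->
  (forall x, D x -> `|m x| <= C) -> sqintegrable u ->
  sqintegrable (fun x => m x * u x).
Proof.
move=> mfm mC lu; have [mfu iu] := lu; split; first exact: measurable_funM.
have [_ iCu] := sqintegrableZ C lu.
apply: le_integrable iCu => //.
  by apply/measurable_EFinP; apply: measurable_funX; exact: measurable_funM.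
move=> x Dx /=; rewrite lee_fin !normrX ler_pXn2r ?nnegrE// !normrM ler_wpM2r//.
exact: le_trans (mC _ Dx) (ler_norm _).
Qed.

Lemma ipDl u v w : sqintegrable u -> sqintegrable v -> sqintegrable w ->
  ip (fun x => u x + v x) w = ip u w + ip v w.
Proof.
move=> lu lv lw; rewrite -RintegralD//; try exact: integrableM.
by apply: eq_Rintegral => x _; rewrite mulrDl.
Qed.

Lemma ipZl k u v : sqintegrable u -> sqintegrable v ->
  ip (fun x => k * u x) v = k * ip u v.
Proof.
move=> lu lv; rewrite -RintegralZl//; last exact: integrableM.
by apply: eq_Rintegral => x _; rewrite mulrA.
Qed.

Lemma ipBl u v w : sqintegrable u -> sqintegrable v -> sqintegrable w ->
  ip (fun x => u x - v x) w = ip u w - ip v w.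
Proof.
move=> lu lv lw; rewrite -RintegralB//; try exact: integrableM.
by apply: eq_Rintegral => x _; rewrite mulrBl.
Qed.

Lemma ipDr u v w : sqintegrable u -> sqintegrable v -> sqintegrable w ->
  ip w (fun x => u x + v x) = ip w u + ip w v.
Proof. by move=> lu lv lw; rewrite ipC ipDl// ![ip w _]ipC. Qed.

Lemma ipBr u v w : sqintegrable u -> sqintegrable v -> sqintegrable w ->
  ip w (fun x => u x - v x) = ip w u - ip w v.
Proof. by move=> lu lv lw; rewrite ipC ipBl// ![ip w _]ipC. Qed.

Lemma ipZr k u v : sqintegrable u -> sqintegrable v ->
  ip u (fun x => k * v x) = k * ip u v.
Proof. by move=> lu lv; rewrite ipC ipZl// ipC. Qed.

Lemma ip_le_sqr u v : sqintegrable u -> sqintegrable v ->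
  (forall x, D x -> u x ^+ 2 <= v x ^+ 2) -> ip u u <= ip v v.
Proof.
move=> lu lv uv; by apply: le_Rintegral => //; exact: integrableM.
Qed.

Lemma ip_mul_bounded (m u : T -> R) (C : R) : measurable_fun D m ->
  (forall x, D x -> `|m x| <= C) -> sqintegrable u ->
  ip (fun x => m x * u x) (fun x => m x * u x) <= C ^+ 2 * ip u u.
Proof.
move=> mfm mC lu.
have -> : C ^+ 2 * ip u u = ip (fun x => C * u x) (fun x => C * u x).
  by rewrite ipZl ?ipZr// ?mulrA//; exact: sqintegrableZ.
apply: ip_le_sqr.
- exact: sqintegrableM mC lu.
- by apply: sqintegrableZ.
- move=> x Dx; rewrite !exprMn ler_wpM2r ?sqr_ge0// -real_normK ?num_real//.
  rewrite ler_pXn2r ?nnegrE// ?mC//; exact: le_trans (normr_ge0 _) (mC _ Dx).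
Qed.

Lemma ip_addE u v : sqintegrable u -> sqintegrable v ->
  ip (fun x => u x + v x) (fun x => u x + v x) =
  ip u u + 2 * ip u v + ip v v.
Proof.
move=> lu lv; have ld := sqintegrableD lu lv.
rewrite (ipDl lu lv ld) (ipDr lu lv lu) (ipDr lu lv lv) (ipC v u); ring.
Qed.

Lemma ip_subE u v : sqintegrable u -> sqintegrable v ->
  ip (fun x => u x - v x) (fun x => u x - v x) =
  ip u u - 2 * ip u v + ip v v.
Proof.
move=> lu lv; have ld := sqintegrableB lu lv.
rewrite (ipBl lu lv ld) (ipBr lu lv lu) (ipBr lu lv lv) (ipC v u); ring.
Qed.

Lemma ip_sub_le u v : sqintegrable u -> sqintegrable v ->
  ip (fun x => u x - v x) (fun x => u x - v x) <= 2 * ip u u + 2 * ip v v.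
Proof.
move=> lu lv; have := ip_ge0 (fun x => u x + v x).
by rewrite ip_addE// ip_subE//; lra.
Qed.

Lemma Cauchy_Schwarz u v : sqintegrable u -> sqintegrable v ->
  ip u v ^+ 2 <= ip u u * ip v v.
Proof.
move=> lu lv.
have h (s r : R) : 0 <= s ^+ 2 * ip u u - 2 * s * r * ip u v + r ^+ 2 * ip v v.
  have := ip_ge0 (fun x => s * u x - r * v x).
  have lsu := sqintegrableZ s lu; have lrv := sqintegrableZ r lv.
  rewrite ip_subE// (ipZl _ lu lsu) (ipZr _ lu lu) (ipZl _ lu lrv).
  rewrite (ipZr _ lu lv) (ipZl _ lv lrv) (ipZr _ lv lv); lra.
(* Write [U], [V], [B] for [ip u u], [ip v v], [ip u v]. If [U = 0], the choice [s = V + 1], [r = B]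
   gives [0 <= - B^2 (V + 2)]; otherwise [s = B], [r = U] gives [0 <= U (U V - B^2)]. *)
have [u0|u0] := eqVneq (ip u u) 0.
  have := h (ip v v + 1) (ip u v); rewrite u0 mul0r; have := ip_ge0 v; nra.
have := h (ip u v) (ip u u).
have {u0} : 0 < ip u u by rewrite lt_neqAle eq_sym u0 ip_ge0.
have := ip_ge0 v; nra.
Qed.

Lemma ip_subC u v :
  ip (fun x => u x - v x) (fun x => u x - v x) =
  ip (fun x => v x - u x) (fun x => v x - u x).
Proof. by apply: eq_Rintegral => x _; ring. Qed.

(** Square integrability is bundled with the convergence, so that limits can be combined without
    side conditions. *)
Definition cvg_l2 (un : (T -> R)^nat) u : Prop :=
  [/\ forall n, sqintegrable (un n), sqintegrable u &
      ip (fun x => un n x - u x) (fun x => un n x - u x) @[n --> \oo] --> 0].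

Lemma cvg_l2_cst u : sqintegrable u -> cvg_l2 (fun=> u) u.
Proof.
move=> lu; split => //.
rewrite (_ : (fun _ => _) = cst 0); first exact: cvg_cst.
apply/funext => n; rewrite /ip.
under eq_Rintegral do rewrite subrr mulr0.
by rewrite Rintegral_cst// mul0r.
Qed.

Lemma cvg_l2_ip un u vn v : cvg_l2 un u -> cvg_l2 vn v ->
  ip (un n) (vn n) @[n --> \oo] --> ip u v.
Proof.
move=> [lun lu cu] [lvn lv cv].
have lu' n := sqintegrableB (lun n) lu.
have lv' n := sqintegrableB (lvn n) lv.
(* By Cauchy-Schwarz a pairing vanishes in the limit when one factor tends to 0 in norm and the norm
   of the other converges. Each error term in the expansion of [ip (un n) (vn n)] around [ip u v] is
   of this kind. *)
have small (p q : (T -> R)^nat) (C : R) : (forall n, sqintegrable (p n)) ->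
    (forall n, sqintegrable (q n)) -> ip (p n) (p n) @[n --> \oo] --> 0 ->
    ip (q n) (q n) @[n --> \oo] --> C -> ip (p n) (q n) @[n --> \oo] --> 0.
  move=> lp lq p0 qC.
  apply: (@sqr_bound_cvg0 _ _ (fun n => ip (p n) (p n) * ip (q n) (q n))).
    by move=> n; exact: Cauchy_Schwarz.
  by rewrite -(mul0r C); exact: cvgM.
have -> : (fun n => ip (un n) (vn n)) = (fun n =>
    ip (fun x => un n x - u x) (fun x => vn n x - v x) +
    ip (fun x => un n x - u x) v + ip (fun x => vn n x - v x) u + ip u v).
  apply/funext => n.
  rewrite !ipBl// !ipBr// (ipC v u) (ipC _ u); ring.
rewrite -[X in _ --> X]add0r; apply: cvgD; last exact: cvg_cst.
rewrite -[X in _ --> X]add0r; apply: cvgD; last first.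
  exact: (small _ (fun=> u) (ip u u) lv' (fun=> lu) cv (cvg_cst _)).
rewrite -[X in _ --> X]add0r; apply: cvgD.
  exact: (small _ _ 0 lu' lv' cu cv).
exact: (small _ (fun=> v) (ip v v) lu' (fun=> lv) cu (cvg_cst _)).
Qed.

Lemma cvg_l2Z k un u : cvg_l2 un u ->
  cvg_l2 (fun n x => k * un n x) (fun x => k * u x).
Proof.
move=> [lun lu cu]; split; first by move=> n; exact: sqintegrableZ.
  exact (sqintegrableZ k lu).
have -> : (fun n => ip (fun x => k * un n x - k * u x) (fun x => k * un n x - k * u x)) =
  (fun n => k ^+ 2 * ip (fun x => un n x - u x) (fun x => un n x - u x)).
  apply/funext => n; have lb := sqintegrableB (lun n) lu.
  rewrite expr2 -mulrA -ipZr// -ipZl//; last exact: sqintegrableZ.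
  by apply: eq_ip => x _; rewrite mulrBr.
by rewrite -[X in _ --> X](mulr0 (k ^+ 2)); apply: cvgM => //; exact: cvg_cst.
Qed.

Lemma cvg_l2_le un u (r : R^nat) : (forall n, sqintegrable (un n)) ->
  sqintegrable u -> r @ \oo --> 0 ->
  (forall n, ip (fun x => un n x - u x) (fun x => un n x - u x) <= r n) ->
  cvg_l2 un u.
Proof.
move=> lun lu r0 h; split => //.
apply: (@squeeze_cvgr _ _ _ _ (cst 0) r) => //; last exact: cvg_cst.
by apply: nearW => n; rewrite ip_ge0 h.
Qed.

Lemma cvg_l2B un u vn v : cvg_l2 un u -> cvg_l2 vn v ->
  cvg_l2 (fun n x => un n x - vn n x) (fun x => u x - v x).
Proof.
move=> [lun lu cu] [lvn lv cv].
apply: (@cvg_l2_le _ _ (fun n =>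
    2 * ip (fun x => un n x - u x) (fun x => un n x - u x) +
    2 * ip (fun x => vn n x - v x) (fun x => vn n x - v x))).
- by move=> n; exact: sqintegrableB.
- exact: sqintegrableB.
- rewrite -[X in _ --> X](addr0 0) -[X in _ --> X + X](mulr0 2).
  by apply: cvgD; apply: cvgM => //; exact: cvg_cst.
- move=> n.
  have -> : ip (fun x => un n x - vn n x - (u x - v x))
       (fun x => un n x - vn n x - (u x - v x)) =
    ip (fun x => (un n x - u x) - (vn n x - v x))
       (fun x => (un n x - u x) - (vn n x - v x)).
    by apply: eq_ip => x _; ring.
  by apply: ip_sub_le; exact: sqintegrableB.
Qed.

Lemma cvg_l2M un u (m : T -> R) (C : R) : measurable_fun D m ->
  (forall x, D x -> `|m x| <= C) -> cvg_l2 un u ->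
  cvg_l2 (fun n x => m x * un n x) (fun x => m x * u x).
Proof.
move=> mfm mC [lun lu cu].
apply: (@cvg_l2_le _ _ (fun n =>
    C ^+ 2 * ip (fun x => un n x - u x) (fun x => un n x - u x))).
- by move=> n; exact: sqintegrableM mC (lun n).
- exact: sqintegrableM mC lu.
- by rewrite -[X in _ --> X](mulr0 (C ^+ 2)); apply: cvgM => //; exact: cvg_cst.
- move=> n.
  rewrite [leLHS](_ : _ = ip (fun x => m x * (un n x - u x))
       (fun x => m x * (un n x - u x))).
    by apply: ip_mul_bounded mC _ => //; exact: sqintegrableB.
  by apply: eq_ip => x _; ring.
Qed.

(** Dominated convergence with majorant [2 C^2 + 2 u^2]: the limit is only known to be square
    integrable, so its square stays in the majorant. *)
Lemma bounded_cvg_l2 (un : (T -> R)^nat) u (C : R) : (mu D < +oo)%E ->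
  (forall n, measurable_fun D (un n)) ->
  (forall n x, D x -> `|un n x| <= C) -> sqintegrable u ->
  {ae mu, forall x, D x -> un n x @[n --> \oo] --> u x} -> cvg_l2 un u.
Proof.
move=> muD mun unC lu cu.
have lun n : sqintegrable (un n) by exact: sqintegrable_bounded (unC n).
split => //.
pose F n x := ((un n x - u x) ^+ 2)%:E.
pose g x := (2 * C ^+ 2 + 2 * u x ^+ 2)%:E.
have ig : mu.-integrable D g.
  have : mu.-integrable D ((EFin \o (fun=> 2 * C ^+ 2)%R) \+
      (fun x => 2%:E * (EFin \o (fun x => (u x ^+ 2)%R)) x))%E.
    apply: integrableD => //.
      apply: measurable_bounded_integrable => //.
      exists (`|2 * C ^+ 2|); split; first exact: num_real.
      by move=> M ltM x _ /=; apply/ltW.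
    by apply: integrableZl => //; case: lu.
  by apply: eq_integrable => // x _ /=; rewrite -EFinM -EFinD.
have mF n : measurable_fun D (F n).
  apply/measurable_EFinP; apply: measurable_funX.
  by apply: measurable_funB => //; case: lu.
have := @dominated_convergence _ _ _ mu D mD F (cst 0%E) g mF.
case.
- exact: measurable_cst.
- apply: filterS cu => x + Dx => /(_ Dx) cu.
  apply: cvg_EFin; first by apply: nearW.
  have cd : (fun n => un n x - u x) @ \oo --> (0 : R).
    by rewrite -(subrr (u x)); apply: cvgB => //; exact: cvg_cst.
  by have := cvgM cd cd; rewrite mulr0 => cd2; exact: cd2.
- exact: ig.
- apply: aeW => x n Dx; rewrite /F /g /= lee_fin normrX real_normK ?num_real//.
  have : un n x ^+ 2 <= C ^+ 2.
    rewrite -real_normK ?num_real// ler_pXn2r ?nnegrE ?unC//.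
    exact: le_trans (normr_ge0 _) (unC n _ Dx).
  by have := sqr_ge0 (un n x + u x); nra.
- move=> _ _; rewrite integral0 => /fine_cvgP[_] /=.
  apply: cvg_trans; apply: near_eq_cvg; apply: nearW => n /=.
  by rewrite /ip /Rintegral; congr fine; apply: eq_integral => x _; rewrite /F expr2.
Qed.

End square_integrable.

(** * Trigonometric sums *)

Section real_derivatives.
Context {R : realType}.
Implicit Types (f g df dg : R -> R) (x y k : R).

Lemma is_derive1_add f g x (a b : R) : is_derive x 1 f a -> is_derive x 1 g b ->
  is_derive x 1 (fun y => f y + g y) (a + b).
Proof. exact: is_deriveD. Qed.

Lemma is_derive1_sub f g x (a b : R) : is_derive x 1 f a -> is_derive x 1 g b ->
  is_derive x 1 (fun y => f y - g y) (a - b).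
Proof. exact: is_deriveB. Qed.

Lemma is_derive1_mul f g x (a b : R) : is_derive x 1 f a -> is_derive x 1 g b ->
  is_derive x 1 (fun y => f y * g y) (a * g x + f x * b).
Proof.
move=> fa gb; apply: (is_derive_eq (is_deriveM fa gb)).
by rewrite addrC /GRing.scale/= [g x * a]mulrC.
Qed.

Lemma is_derive1_scale f x (a k : R) : is_derive x 1 f a ->
  is_derive x 1 (fun y => k * f y) (k * a).
Proof.
move=> fa; apply: (is_derive_eq (is_derive1_mul (is_derive_cst k x 1) fa)).
by rewrite mul0r add0r.
Qed.

Lemma is_derive1_chain f g x (a b : R) : is_derive (g x) 1 f a ->
  is_derive x 1 g b -> is_derive x 1 (fun y => f (g y)) (a * b).
Proof. exact: is_derive1_comp. Qed.

Lemma is_derive1_big (I : Type) (r : seq I) (h dh : I -> R -> R) x :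
  (forall i, is_derive x 1 (h i) (dh i x)) ->
  is_derive x 1 (fun y => \sum_(i <- r) h i y) (\sum_(i <- r) dh i x).
Proof.
move=> hd; elim: r => [|i r IH].
  rewrite big_nil (_ : (fun _ => _) = cst 0); first exact: is_derive_cst.
  by apply/funext => y; rewrite big_nil.
rewrite big_cons (_ : (fun _ => _) = fun y => h i y + \sum_(j <- r) h j y).
  exact: is_derive1_add.
by apply/funext => y; rewrite big_cons.
Qed.

Lemma is_derive1_continuous f x (a : R) : is_derive x 1 f a ->
  {for x, continuous f}.
Proof. by move=> fa; apply/differentiable_continuous/derivable1_diffP. Qed.

Lemma is_derive1_within f df (A : set R) :
  (forall x, A x -> is_derive x 1 f (df x)) -> {within A, continuous f}.
Proof.
move=> h; apply: continuous_in_subspaceT => x; rewrite inE => Ax.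
exact: is_derive1_continuous (h _ Ax).
Qed.

Lemma is_derive1_mono f df x y : x <= y ->
  (forall z : R, is_derive z 1 f (df z)) -> (forall z, 0 <= df z) -> f x <= f y.
Proof.
move=> xy h df0.
have [|c _] := @MVT_segment _ f df _ _ xy (fun z _ => h z).
  exact: (@is_derive1_within f df) (fun z _ => h z).
by move/eqP; rewrite subr_eq => /eqP ->; rewrite lerDr mulr_ge0// subr_ge0.
Qed.

(* Cauchy-Schwarz for [g y - g x = \int_x^y dg] without integrals: the
   derivative of [f - 2 m g + m^2 id] is [(dg - m)^2]. *)
Lemma is_derive1_Jensen f g dg x y : x <= y ->
  (forall z : R, is_derive z 1 g (dg z)) ->
  (forall z : R, is_derive z 1 f (dg z ^+ 2)) ->
  (g y - g x) ^+ 2 <= (f y - f x) * (y - x).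
Proof.
rewrite le_eqVlt => /predU1P[->|xy] hg hf; first by rewrite !subrr expr0n mulr0.
have yx : 0 < y - x by rewrite subr_gt0.
pose m := (g y - g x) / (y - x).
have mE : m * (y - x) = g y - g x by rewrite divfK// gt_eqF.
have h (z : R) : is_derive z 1 (fun z => f z + (- (2 * m) * g z + m ^+ 2 * z))
    ((dg z - m) ^+ 2).
  apply: (is_derive_eq (is_derive1_add (hf z) (is_derive1_add
    (is_derive1_scale (- (2 * m)) (hg z))
    (is_derive1_scale (m ^+ 2) (is_derive_id z 1))))).
  by rewrite /=; ring.
have := is_derive1_mono (ltW xy) h (fun z => sqr_ge0 _).
rewrite -mE => H.
have : m ^+ 2 * (y - x) <= f y - f x by move: mE; nra.
nra.
Qed.

End real_derivatives.

(** * Primitives over one period and Parseval's identity for finite sums *)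

Section trigonometric_sums.
Context {R : realType}.
Implicit Types (h : R -> R) (P e : R).

(** The integral of [h] over any period is [e], expressed as the increment of a primitive.
    Parseval's identity becomes algebra on primitives, and the primitive of the squared derivative
    is the [G] needed later. *)
Definition period_integral P h e : Prop :=
  exists H : R -> R,
    (forall y : R, is_derive y 1 H (h y)) /\ forall y, H (y + P) = H y + e.

Lemma eq_period_integral P h h' e e' : h =1 h' -> e = e' ->
  period_integral P h e -> period_integral P h' e'.
Proof. by move=> /funext -> ->. Qed.

Lemma period_integralD P h h' e e' : period_integral P h e ->
  period_integral P h' e' -> period_integral P (fun y => h y + h' y) (e + e').
Proof.
move=> [H [dH pH]] [H' [dH' pH']]; exists (fun y => H y + H' y); split.
  by move=> y; exact: is_derive1_add.
by move=> y; rewrite pH pH'; ring.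
Qed.

Lemma period_integralZ P k h e : period_integral P h e ->
  period_integral P (fun y => k * h y) (k * e).
Proof.
move=> [H [dH pH]]; exists (fun y => k * H y); split.
  by move=> y; exact: is_derive1_scale.
by move=> y; rewrite pH; ring.
Qed.

Lemma period_integral_sum P (I : Type) (r : seq I) (h : I -> R -> R) (e : I -> R) :
  (forall i, period_integral P (h i) (e i)) ->
  period_integral P (fun y => \sum_(i <- r) h i y) (\sum_(i <- r) e i).
Proof.
move=> hd; elim: r => [|i r IH].
  exists (cst 0); split=> y; last by rewrite big_nil addr0.
  by rewrite big_nil; exact: is_derive_cst.
apply: eq_period_integral (period_integralD (hd i) IH); last by rewrite big_cons.
by move=> y; rewrite big_cons.
Qed.

Lemma period_integral_cst P k : period_integral P (fun=> k) (k * P).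
Proof.
exists (fun y => k * y); split=> y; last by rewrite mulrDr.
by have := is_derive1_scale k (is_derive_id y 1); rewrite mulr1.
Qed.

Variable w : R.
Hypothesis w0 : 0 < w.
Let P := 2 * pi / w.

Let wP : w * P = pi *+ 2.
Proof. by rewrite /P mulrCA divff ?gt_eqF// mulr1 mulr_natl. Qed.

Let period_nat (k : nat) y : k%:R * (w * (y + P)) = k%:R * (w * y) + pi *+ 2 *+ k.
Proof. by rewrite mulrDr wP mulrDr mulr_natl mulr_natl. Qed.

Lemma cos_period (k : nat) y : cos (k%:R * (w * (y + P))) = cos (k%:R * (w * y)).
Proof. by rewrite period_nat (periodicn (@cosD2pi R)). Qed.

Lemma sin_period (k : nat) y : sin (k%:R * (w * (y + P))) = sin (k%:R * (w * y)).
Proof. by rewrite period_nat (periodicn (@sinD2pi R)). Qed.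

Lemma is_derive_cosk (k y : R) :
  is_derive y 1 (fun y => cos (k * (w * y))) (- (k * w) * sin (k * (w * y))).
Proof.
have h : is_derive y 1 (fun y => k * (w * y)) (k * w).
  apply: is_derive1_scale.
  by have := is_derive1_scale w (is_derive_id y 1); rewrite mulr1.
apply: (is_derive_eq (is_derive1_chain (is_derive_cos _) h)).
by rewrite /=; ring.
Qed.

Lemma is_derive_sink (k y : R) :
  is_derive y 1 (fun y => sin (k * (w * y))) (k * w * cos (k * (w * y))).
Proof.
have h : is_derive y 1 (fun y => k * (w * y)) (k * w).
  apply: is_derive1_scale.
  by have := is_derive1_scale w (is_derive_id y 1); rewrite mulr1.
apply: (is_derive_eq (is_derive1_chain (is_derive_sin _) h)).
by rewrite /=; ring.
Qed.

Lemma period_integral_cos (k : nat) :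
  period_integral P (fun y => cos (k%:R * (w * y))) (if k == 0%N then P else 0).
Proof.
case: eqP => [->|/eqP k0].
  apply: eq_period_integral (period_integral_cst P 1); last by rewrite mul1r.
  by move=> y; rewrite mul0r cos0.
exists (fun y => (k%:R * w)^-1 * sin (k%:R * (w * y))); split=> y.
  have := is_derive1_scale (k%:R * w)^-1 (is_derive_sink k%:R y).
  by rewrite mulKf// mulf_neq0 ?pnatr_eq0// gt_eqF.
by rewrite sin_period addr0.
Qed.

Lemma period_integral_sin (k : nat) :
  period_integral P (fun y => sin (k%:R * (w * y))) 0.
Proof.
have [->|k0] := eqVneq k 0%N.
  apply: eq_period_integral (period_integral_cst P 0); last by rewrite mul0r.
  by move=> y; rewrite mul0r sin0.
exists (fun y => - (k%:R * w)^-1 * cos (k%:R * (w * y))); split=> y.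
  apply: (is_derive_eq (is_derive1_scale (- (k%:R * w)^-1)
    (is_derive_cosk k%:R y))).
  by rewrite !mulNr mulrN opprK mulKf// mulf_neq0 ?pnatr_eq0// gt_eqF.
by rewrite cos_period addr0.
Qed.

(** This is [|j - k|], one of the truncated differences being 0. It keeps the frequencies in the
    product-to-sum formulas natural numbers. *)
Let dist (j k : nat) : nat := (j - k + (k - j))%N.

Let cos_diff (j k : nat) y : cos (j%:R * (w * y) - k%:R * (w * y)) =
  cos ((dist j k)%:R * (w * y)).
Proof.
have [kj|/ltnW jk] := leqP k j; rewrite -mulrBl /dist.
  by rewrite -natrB// (eqP kj) addn0.
by rewrite -cosN -mulNr opprB -natrB// (eqP jk).
Qed.

Let sin_diff (j k : nat) y : sin (j%:R * (w * y) - k%:R * (w * y)) =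
  (if (k <= j)%N then 1 else -1) * sin ((dist j k)%:R * (w * y)).
Proof.
have [kj|/ltnW jk] := leqP k j; rewrite -mulrBl /dist.
  by rewrite -natrB// (eqP kj) addn0 mul1r.
by rewrite mulN1r; apply: oppr_inj; rewrite opprK -sinN -mulNr opprB -natrB// (eqP jk).
Qed.

Let dist_eq0 (j k : nat) : (dist j k == 0)%N = (j == k).
Proof. by rewrite addn_eq0 -eqn_leq. Qed.

(** Product-to-sum formula: only frequency 0 contributes. The frequency [j + k] is never 0 for
    positive [j], and [|j - k|] is 0 exactly on the diagonal. *)
Lemma period_integral_coscos (j k : nat) : (0 < j)%N -> (0 < k)%N ->
  period_integral P (fun y => cos (j%:R * (w * y)) * cos (k%:R * (w * y)))
    (if j == k then P / 2 else 0).
Proof.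
move=> j0 k0.
apply: eq_period_integral (period_integralZ 2^-1 (period_integralD
  (period_integral_cos (dist j k)) (period_integral_cos (j + k)))).
  move=> y; rewrite -cos_diff natrD mulrDl cosB cosD; lra.
rewrite dist_eq0 addn_eq0 (gtn_eqF j0) /=.
by case: ifP => _; rewrite addr0 ?mulr0// mulrC.
Qed.

Lemma period_integral_sinsin (j k : nat) : (0 < j)%N -> (0 < k)%N ->
  period_integral P (fun y => sin (j%:R * (w * y)) * sin (k%:R * (w * y)))
    (if j == k then P / 2 else 0).
Proof.
move=> j0 k0.
apply: eq_period_integral (period_integralZ 2^-1 (period_integralD
  (period_integral_cos (dist j k))
  (period_integralZ (-1) (period_integral_cos (j + k))))).
  move=> y; rewrite -cos_diff natrD mulrDl cosB cosD; lra.
rewrite dist_eq0 addn_eq0 (gtn_eqF j0) /= mulr0.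
by case: ifP => _; rewrite addr0 ?mulr0// mulrC.
Qed.

Lemma period_integral_sincos (j k : nat) : 
  period_integral P (fun y => sin (j%:R * (w * y)) * cos (k%:R * (w * y))) 0.
Proof.
apply: eq_period_integral (period_integralZ 2^-1 (period_integralD
  (period_integralZ (if (k <= j)%N then 1 else -1)
     (period_integral_sin (dist j k))) (period_integral_sin (j + k)))).
  move=> y; rewrite -sin_diff natrD mulrDl sinB sinD; lra.
by rewrite mulr0 addr0 mulr0.
Qed.

Implicit Types (p q : nat -> R) (m n N : nat).

(** The frequencies are those with [m < k <= n]: partial sums have [m = 0], and a difference of
    partial sums is again of this form, so the results apply to remainders as well. *)
Definition trig p q m n y : R := \sum_(m.+1 <= k < n.+1)
  (p k * cos (k%:R * (w * y)) + q k * sin (k%:R * (w * y))).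

(** Differentiation on coefficients: the derivative of the sum with coefficients [p], [q] has cosine
    coefficients [dcos q] and sine coefficients [dsin p]. *)
Definition dcos p : nat -> R := fun k => k%:R * w * p k.
Definition dsin p : nat -> R := fun k => - (k%:R * w * p k).

Lemma is_derive_trig p q m n (y : R) :
  is_derive y 1 (trig p q m n) (trig (dcos q) (dsin p) m n y).
Proof.
rewrite /trig; apply: (@is_derive1_big _ _ _ _ (fun k y =>
  dcos q k * cos (k%:R * (w * y)) + dsin p k * sin (k%:R * (w * y)))) => k.
apply: (is_derive_eq (is_derive1_add
  (is_derive1_scale (p k) (is_derive_cosk k%:R y))
  (is_derive1_scale (q k) (is_derive_sink k%:R y)))).
by rewrite /dcos /dsin; ring.
Qed.

Lemma trig_period p q m n y : trig p q m n (y + P) = trig p q m n y.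
Proof. by apply: eq_bigr => k _; rewrite cos_period sin_period. Qed.

Lemma trig_sub p q m n y : (m <= n)%N ->
  trig p q 0 n y - trig p q 0 m y = trig p q m n y.
Proof.
by move=> mn; rewrite /trig (@big_cat_nat _ _ _ m.+1)//= [X in X - _]addrC addrK.
Qed.

Lemma trig_bounded p q m n : exists C, forall y, `|trig p q m n y| <= C.
Proof.
exists (\sum_(m.+1 <= k < n.+1) (`|p k| + `|q k|)) => y.
apply: le_trans (ler_norm_sum _ _ _) _; apply: ler_sum => k _.
apply: le_trans (ler_normD _ _) _; rewrite !normrM.
by apply: lerD; rewrite ler_piMr// ler_norml ?cos_geN1 ?cos_le1 ?sin_geN1 ?sin_le1.
Qed.

Lemma period_integral_trig_sqr p q m n :
  period_integral P (fun y => trig p q m n y ^+ 2)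
    (P / 2 * \sum_(m.+1 <= k < n.+1) (p k ^+ 2 + q k ^+ 2)).
Proof.
(* After this shift the frequencies have the form [k.+1], which makes the positivity conditions of
   the orthogonality relations immediate. *)
rewrite big_add1 /=.
pose c (k : nat) y : R := cos (k.+1%:R * (w * y)).
pose s (k : nat) y : R := sin (k.+1%:R * (w * y)).
pose h j k y := p j.+1 * p k.+1 * (c j y * c k y) +
  q j.+1 * q k.+1 * (s j y * s k y) +
  (q j.+1 * p k.+1 * (s j y * c k y) + p j.+1 * q k.+1 * (s k y * c j y)).
pose e j k : R :=
  if j == k then P / 2 * (p j.+1 * p k.+1 + q j.+1 * q k.+1) else 0.
have he j k : period_integral P (h j k) (e j k).
  apply: eq_period_integral (period_integralD (period_integralD
    (period_integralZ (p j.+1 * p k.+1) (@period_integral_coscos j.+1 k.+1 _ _))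
    (period_integralZ (q j.+1 * q k.+1) (@period_integral_sinsin j.+1 k.+1 _ _)))
    (period_integralD
    (period_integralZ (q j.+1 * p k.+1) (period_integral_sincos j.+1 k.+1))
    (period_integralZ (p j.+1 * q k.+1) (period_integral_sincos k.+1 j.+1)))) => //.
  by rewrite /e eqSS; case: ifP => _; ring.
have := period_integral_sum (index_iota m n)
  (fun j => period_integral_sum (index_iota m n) (he j)).
apply: eq_period_integral => [y|].
  rewrite /trig big_add1 /= expr2 big_distrlr /=.
  by apply: eq_bigr => j _; apply: eq_bigr => k _; rewrite /h /c /s; ring.
rewrite mulr_sumr big_seq [RHS]big_seq; apply: eq_bigr => j jmn.
rewrite (bigD1_seq j) ?iota_uniq//= /e eqxx big1 ?addr0 ?expr2// => k.
by rewrite eq_sym => /negbTE ->.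
Qed.

End trigonometric_sums.

(** * Integration by parts on a segment *)

Section continuous_on_segment.
Context {R : realType}.
Notation mu := (@lebesgue_measure R).
Variables (a b : R).
Implicit Types (u v F f : R -> R).

(** Continuity is two-sided even at the end points. The functions concerned are smooth in a
    neighbourhood of the segment, so no one-sided limits have to be treated. *)
Definition continuous_on u := forall x, a <= x <= b -> {for x, continuous u}.

Lemma continuous_on_within u : continuous_on u -> {within `[a, b], continuous u}.
Proof.
move=> cu; apply: continuous_in_subspaceT => x; rewrite inE /= in_itv /=.
exact: cu.
Qed.

Lemma continuous_on_integrable u : continuous_on u ->
  mu.-integrable `[a, b] (EFin \o u).
Proof.
move=> /continuous_on_within cu; apply: continuous_compact_integrable cu.
exact: segment_compact.
Qed.

Lemma continuous_onM u v : continuous_on u -> continuous_on v ->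
  continuous_on (fun x => u x * v x).
Proof. by move=> cu cv x abx; apply: continuousM; [exact: cu|exact: cv]. Qed.

Lemma continuous_onD u v : continuous_on u -> continuous_on v ->
  continuous_on (fun x => u x + v x).
Proof. by move=> cu cv x abx; apply: continuousD; [exact: cu|exact: cv]. Qed.

Lemma continuous_onB u v : continuous_on u -> continuous_on v ->
  continuous_on (fun x => u x - v x).
Proof. by move=> cu cv x abx; apply: continuousB; [exact: cu|exact: cv]. Qed.

Lemma continuous_on_measurable u : continuous_on u ->
  measurable_fun (`]a, b[ : set (measurableTypeR R)) u.
Proof.
move=> /continuous_on_within cu.
apply: (@measurable_funS _ _ (measurableTypeR R) _ `[a, b]) => //.
  exact: subset_itv_oo_cc.
exact: subspace_continuous_measurable_fun.
Qed.

Lemma continuous_on_bounded u : continuous_on u ->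
  exists C, forall x, a < x < b -> `|u x| <= C.
Proof.
move=> /continuous_on_within cu.
have /compact_bounded[M [_ mrt]] := continuous_compact cu (@segment_compact _ a b).
exists (M + 1) => x /andP[ax xb]; apply: mrt; first by rewrite ltrDl.
by exists x => //; rewrite /= in_itv /= !ltW.
Qed.

Lemma itv_oo_lty : (mu (`]a, b[ : set R) < +oo)%E.
Proof. by rewrite lebesgue_measure_itv /=; case: ifP => _; rewrite -?EFinD ltry. Qed.

Lemma continuous_on_sqintegrable u : continuous_on u ->
  sqintegrable mu `]a, b[ u.
Proof.
move=> cu; have [C uC] := continuous_on_bounded cu.
apply: (@sqintegrable_bounded _ _ _ mu _ _ u C).
- exact: measurable_itv.
- exact: itv_oo_lty.
- exact: continuous_on_measurable.
- by move=> x; rewrite /= in_itv /=; exact: uC.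
Qed.

Lemma Rintegral_FTC F f : a < b ->
  (forall x, a <= x <= b -> is_derive x 1 F (f x)) -> continuous_on f ->
  \int[mu]_(x in `]a, b[) f x = F b - F a.
Proof.
move=> ab dF cf.
have cF : continuous_on F by move=> x /dF; exact: is_derive1_continuous.
have /(continuous_FTC2 ab (continuous_on_within cf)) h :
    derivable_oo_LRcontinuous F a b.
  have [aab bab] : a <= a <= b /\ a <= b <= b by rewrite !lexx (ltW ab).
  split.
  - by move=> x; rewrite in_itv /= => /andP[ax xb]; apply: ex_derive; apply: dF; rewrite !ltW.
  - by apply: cvg_at_right_filter; exact: cF.
  - by apply: cvg_at_left_filter; exact: cF.
rewrite /Rintegral -(@integral_itv_bndoo _ a b (EFin \o f) true false).
  rewrite h //= => x; rewrite in_itv /= => /andP[ax xb].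
  by rewrite derive1E; have [|_ ->] := dF x _; rewrite ?ltW.
by apply/measurable_EFinP; exact: continuous_on_measurable.
Qed.

(** The boundary conditions are put on [u] alone, because in the application [v] involves an
    x-derivative of a wave, which does not vanish at the ends in general. *)
Lemma ip_by_parts u v (du dv : R -> R) : a < b -> u a = 0 -> u b = 0 ->
  (forall x, a <= x <= b -> is_derive x 1 u (du x)) ->
  (forall x, a <= x <= b -> is_derive x 1 v (dv x)) ->
  continuous_on du -> continuous_on dv ->
  ip mu `]a, b[ du v = - ip mu `]a, b[ u dv.
Proof.
move=> ab ua ub hu hv cdu cdv.
have cu : continuous_on u by move=> x /hu; exact: is_derive1_continuous.
have cv : continuous_on v by move=> x /hv; exact: is_derive1_continuous.
have l (f : R -> R) (c : continuous_on f) := continuous_on_sqintegrable c.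
apply/eqP; rewrite -addr_eq0 -RintegralD//; try exact: integrableM (l _ _) (l _ _).
apply/eqP; transitivity (u b * v b - u a * v a); last by rewrite ua ub; ring.
apply: (@Rintegral_FTC (fun x => u x * v x)) => // [x abx|].
  by apply: is_derive1_mul; [exact: hu|exact: hv].
by apply: continuous_onD; exact: continuous_onM.
Qed.

End continuous_on_segment.

(** * Superpositions of two logarithmic profiles *)

Section log_profile.
Context {R : realType}.
Implicit Types (c x z s t : R) (h dh : R -> R).

(** This family is closed under differentiation: the exponent goes up by one and [h] becomes
    [h' - k h]. All derivatives of the two travelling waves are thus instances of it. *)
Definition logp c (k : nat) h z := h (c + ln z) / z ^+ k.

Lemma is_derive_logp c k h dh z : 0 < z ->
  (forall y : R, is_derive y 1 h (dh y)) ->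
  is_derive z 1 (logp c k h) (logp c k.+1 (fun y => dh y - k%:R * h y) z).
Proof.
move=> z0 hd; have zn0 : z != 0 by rewrite gt_eqF.
have dl : is_derive z 1 (fun z => c + ln z) (0 + z^-1).
  exact: is_derive1_add (is_derive_cst c z 1) (is_derive1_ln z0).
have dX : is_derive z 1 (fun z : R => z ^+ k) (k%:R * z ^+ k.-1).
  elim: k => [|k IH]; first by rewrite mul0r; exact: is_derive_cst.
  under eq_fun do rewrite exprS.
  apply: (is_derive_eq (is_derive1_mul (is_derive_id z 1) IH)).
  by case: k {IH} => [|k] /=; rewrite ?expr0 ?exprS -?natr1; ring.
have dV : is_derive z 1 (fun z : R => (z ^+ k)^-1) (- (z ^+ k) ^- 2 * (k%:R * z ^+ k.-1)).
  by apply: (is_deriveV _ dX); rewrite expf_neq0.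
apply: (is_derive_eq (is_derive1_mul (is_derive1_chain (hd _) dl) dV)).
rewrite /logp add0r; case: k {dX dV} => [|k] /=.
  by rewrite !expr0 !mul0r expr1 subr0; field.
by rewrite !exprS; field; rewrite expf_neq0// zn0.
Qed.

Lemma is_derive_affine (v t x : R) : is_derive x 1 (fun x => t + v * x) v.
Proof.
apply: (is_derive_eq (is_derive1_add (is_derive_cst t x 1)
  (is_derive1_scale v (is_derive_id x 1)))).
by rewrite add0r mulr1.
Qed.

Lemma is_derive_addr (t x : R) : is_derive x 1 (fun x => t + x) 1.
Proof.
apply: (is_derive_eq (is_derive1_add (is_derive_cst t x 1) (is_derive_id x 1))).
by rewrite add0r.
Qed.

Lemma is_derive_subr (t x : R) : is_derive x 1 (fun x => t - x) (- 1).
Proof.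
apply: (is_derive_eq (is_derive1_sub (is_derive_cst t x 1) (is_derive_id x 1))).
by rewrite sub0r.
Qed.

Lemma is_derive_logp_add c k h dh t x : 0 < t + x ->
  (forall y : R, is_derive y 1 h (dh y)) ->
  is_derive x 1 (fun x => logp c k h (t + x))
    (logp c k.+1 (fun y => dh y - k%:R * h y) (t + x)).
Proof.
move=> z0 hd; apply: (is_derive_eq (is_derive1_chain
  (is_derive_logp c k z0 hd) (is_derive_addr t x))).
by rewrite mulr1.
Qed.

Lemma is_derive_logp_sub c k h dh t x : 0 < t - x ->
  (forall y : R, is_derive y 1 h (dh y)) ->
  is_derive x 1 (fun x => logp c k h (t - x))
    (- logp c k.+1 (fun y => dh y - k%:R * h y) (t - x)).
Proof.
move=> z0 hd; apply: is_derive_eq; last exact: mulrN1.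
exact: (@is_derive1_chain _ (logp c k h) (fun x => t - x) x _ _
  (is_derive_logp c k z0 hd) (is_derive_subr t x)).
Qed.

(** d'Alembert form of the solution. For a profile [f], the argument [h] is [f] in [wave], [f'] in
    [wavex] and [wavet], and [f'' - f'] in [wavexx]. *)
Definition wave c h t x := logp 0 0 h (t + x) - logp c 0 h (t - x).
Definition wavex c h t x := logp 0 1 h (t + x) + logp c 1 h (t - x).
Definition wavet c h t x := logp 0 1 h (t + x) - logp c 1 h (t - x).
Definition wavexx c h t x := logp 0 2 h (t + x) - logp c 2 h (t - x).

Lemma waveE c h t x : wave c h t x = h (ln (t + x)) - h (c + ln (t - x)).
Proof. by rewrite /wave /logp expr0 !divr1 add0r. Qed.

Lemma eq_logp c k h dh z : h =1 dh -> logp c k h z = logp c k dh z.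
Proof. by move=> /funext ->. Qed.

Variables (c : R) (f f1 f2 : R -> R) (t x : R).
Hypotheses (df : forall y : R, is_derive y 1 f (f1 y))
  (df1 : forall y : R, is_derive y 1 f1 (f2 y)).
Hypotheses (tx : 0 < t + x) (tNx : 0 < t - x).

Let f1E k y : f1 y - 0%:R * k = f1 y. Proof. by rewrite mul0r subr0. Qed.

Lemma is_derive_wave : is_derive x 1 (wave c f t) (wavex c f1 t x).
Proof.
apply: (is_derive_eq (is_derive1_sub (is_derive_logp_add 0 0 tx df)
  (is_derive_logp_sub c 0 tNx df))).
by rewrite opprK /wavex; congr (_ + _); apply: eq_logp => y; rewrite f1E.
Qed.

Lemma is_derive_wavex :
  is_derive x 1 (wavex c f1 t) (wavexx c (fun y => f2 y - f1 y) t x).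
Proof.
apply: (is_derive_eq (is_derive1_add (is_derive_logp_add 0 1 tx df1)
  (is_derive_logp_sub c 1 tNx df1))).
by rewrite /wavexx; congr (_ - _); apply: eq_logp => y; rewrite mul1r.
Qed.

Lemma is_derive_wavet : is_derive t 1 (fun s => wave c f s x) (wavet c f1 t x).
Proof.
have shift (v : R) : is_derive t 1 (fun s => s + v) 1.
  apply: (is_derive_eq (is_derive1_add (is_derive_id t 1) (is_derive_cst v t 1))).
  by rewrite addr0.
have e : (fun y => f1 y - 0%:R * f y) = f1 by apply/funext => y; rewrite f1E.
have h0 := @is_derive1_chain _ (logp 0 0 f) (fun s => s + x) t _ _
  (is_derive_logp 0 0 tx df) (shift x).
have h1 := @is_derive1_chain _ (logp c 0 f) (fun s => s - x) t _ _
  (is_derive_logp c 0 tNx df) (shift (- x)).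
by apply: (is_derive_eq (is_derive1_sub h0 h1)); rewrite !mulr1 e.
Qed.

End log_profile.

Section real_integrable.
Context d (T : measurableType d) (R : realType).
Variables (mu : {measure set T -> \bar R}) (D : set T).
Hypothesis mD : measurable D.
Implicit Types u v : T -> R.

Lemma integrable_EFinD u v : mu.-integrable D (EFin \o u) ->
  mu.-integrable D (EFin \o v) -> mu.-integrable D (EFin \o (fun x => u x + v x)).
Proof. by move=> iu iv; apply: eq_integrable (integrableD mD iu iv). Qed.

Lemma integrable_EFinZ k u : mu.-integrable D (EFin \o u) ->
  mu.-integrable D (EFin \o (fun x => k * u x)).
Proof. by move=> iu; apply: eq_integrable (integrableZl mD k iu). Qed.

End real_integrable.

(** [e] is the energy of [f] per period, read off as the increment of [G]. The third derivative
    makes [f2] continuous, hence also the second x-derivative of the wave. *)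
Record profile {R : realType} (P e : R) (f f1 f2 f3 G : R -> R) : Prop := {
  profile_d : forall y : R, is_derive y 1 f (f1 y);
  profile_d1 : forall y : R, is_derive y 1 f1 (f2 y);
  profile_d2 : forall y : R, is_derive y 1 f2 (f3 y);
  profile_dG : forall y : R, is_derive y 1 G (f1 y ^+ 2);
  profile_bounded : exists C, forall y, `|f y| <= C;
  profile_bounded1 : exists C, forall y, `|f1 y| <= C;
  profile_period : forall y, f (y + P) = f y;
  profile_periodG : forall y, G (y + P) = G y + e }.

(** * The energy identity and the difference quotient estimate for one profile *)

Section profile_theory.
Context {R : realType}.
Notation mu := (@lebesgue_measure R).
Variables (P e : R) (f f1 f2 f3 G : R -> R).
Hypothesis fP : profile P e f f1 f2 f3 G.
Hypothesis P0 : 0 < P.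

Lemma profile_G_le x y : x <= y -> G x <= G y.
Proof.
by move=> xy; apply: (is_derive1_mono xy (profile_dG fP)) => z; exact: sqr_ge0.
Qed.

Lemma profile_energy_ge0 : 0 <= e.
Proof.
by have := profile_G_le (ltW P0); have := profile_periodG fP 0; rewrite add0r; lra.
Qed.

(** A window of at most one period carries at most the energy of one period, because [G] is
    nondecreasing. *)
Lemma profile_G_le_energy x y : y <= x + P -> G y - G x <= e.
Proof. by move=> /profile_G_le; rewrite (profile_periodG fP); lra. Qed.

Lemma profile_Jensen x y : x <= y -> y <= x + P ->
  (f y - f x) ^+ 2 <= e * (y - x).
Proof.
move=> xy yP; apply: le_trans (is_derive1_Jensen xy (profile_d fP) (profile_dG fP)) _.
by rewrite ler_wpM2r ?subr_ge0// profile_G_le_energy.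
Qed.

Lemma continuous_on_logp_add (h dh : R -> R) c k t a b :
  (forall y : R, is_derive y 1 h (dh y)) -> 0 < t + a ->
  continuous_on a b (fun x => logp c k h (t + x)).
Proof.
move=> hd ta x /andP[ax _].
have tx : 0 < t + x by lra.
exact: is_derive1_continuous (is_derive_logp_add c k tx hd).
Qed.

Lemma continuous_on_logp_sub (h dh : R -> R) c k t a b :
  (forall y : R, is_derive y 1 h (dh y)) -> 0 < t - b ->
  continuous_on a b (fun x => logp c k h (t - x)).
Proof.
move=> hd tb x /andP[_ xb].
have tx : 0 < t - x by lra.
exact: is_derive1_continuous (is_derive_logp_sub c k tx hd).
Qed.

Lemma continuous_logp (h dh : R -> R) c k z :
  (forall y : R, is_derive y 1 h (dh y)) -> 0 < z ->
  {for z, continuous (logp c k h)}.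
Proof. by move=> hd z0; exact: is_derive1_continuous (is_derive_logp c k z0 hd). Qed.

Section segment.
Variables (c t a b : R).
Hypotheses (ta : 0 < t + a) (tb : 0 < t - b) (ab : a < b).
Notation D := (`]a, b[%classic).

Lemma continuous_on_wave : continuous_on a b (wave c f t).
Proof.
by apply: continuous_onB; [apply: continuous_on_logp_add|
  apply: continuous_on_logp_sub] => //; exact: (profile_d fP).
Qed.

Lemma continuous_on_wavex : continuous_on a b (wavex c f1 t).
Proof.
by apply: continuous_onD; [apply: continuous_on_logp_add|
  apply: continuous_on_logp_sub] => //; exact: (profile_d1 fP).
Qed.

Lemma continuous_on_wavet : continuous_on a b (wavet c f1 t).
Proof.
by apply: continuous_onB; [apply: continuous_on_logp_add|
  apply: continuous_on_logp_sub] => //; exact: (profile_d1 fP).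
Qed.

Lemma continuous_on_wavexx : continuous_on a b (wavexx c (fun y => f2 y - f1 y) t).
Proof.
have hd (y : R) : is_derive y 1 (fun y => f2 y - f1 y) (f3 y - f2 y).
  exact: is_derive1_sub (profile_d2 fP y) (profile_d1 fP y).
by apply: continuous_onB; [apply: continuous_on_logp_add|
  apply: continuous_on_logp_sub] => //; exact: hd.
Qed.

(** For [u = phi_x] and [v = phi_t] this is [t E + \int x phi_x phi_t]. Written with inner products,
    it passes to L^2 limits by [cvg_l2_ip]. *)
Definition quad t D (u v : R -> R) : R :=
  t / 2 * (ip mu D u u + ip mu D v v) + ip mu D (fun x => x * u x) v.

Lemma quad_wave : quad t D (wavex c f1 t) (wavet c f1 t) =
  wave c G t b - wave c G t a.
Proof.
have cx := continuous_on_wavex; have ct := continuous_on_wavet.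
have lx := continuous_on_sqintegrable cx.
have lt := continuous_on_sqintegrable ct.
have lxx : sqintegrable mu D (fun x => x * wavex c f1 t x).
  apply: continuous_on_sqintegrable; apply: continuous_onM => // x _.
  exact: cvg_id.
have mD : measurable (D : set (measurableTypeR R)) by exact: measurable_itv.
have ixx := integrableM mD lx lx; have itt := integrableM mD lt lt.
have ixt := integrableM mD lxx lt.
rewrite /quad /ip -RintegralD// -RintegralZl//; last exact: integrable_EFinD.
rewrite -RintegralD//; last by apply: integrable_EFinZ => //; exact: integrable_EFinD.
(* With [A] and [B] the two terms of [wavex], the derivatives are [A + B] and [A - B], so the
   integrand is [t (A^2 + B^2) + x (A^2 - B^2) = (t + x) A^2 + (t - x) B^2]. One factor of each
   denominator cancels, leaving the x-derivative of [wave c G t]. *)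
have E (x : R) : a < x < b -> t / 2 * (wavex c f1 t x * wavex c f1 t x +
    wavet c f1 t x * wavet c f1 t x) + x * wavex c f1 t x * wavet c f1 t x =
    wavex c (fun y => f1 y ^+ 2) t x.
  move=> /andP[ax xb]; rewrite /wavex /wavet /logp !expr1 !add0r.
  have tx : t + x != 0 by rewrite gt_eqF// (lt_trans ta)// ltrD2l.
  have tNx : t - x != 0 by rewrite gt_eqF// (lt_trans tb)// ltrD2l ltrN2.
  by field; rewrite tx tNx.
transitivity (\int[mu]_(x in D) wavex c (fun y => f1 y ^+ 2) t x).
  by apply: eq_Rintegral => x; rewrite inE /= in_itv /= => /E.
apply: Rintegral_FTC => //.
- by move=> x /andP[ax xb]; apply: is_derive_wave; [exact: (profile_dG fP)|
    move: ta; lra|move: tb; lra].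
- have hd (y : R) : is_derive y 1 (fun y => f1 y ^+ 2) (2 * f1 y * f2 y).
    apply: (is_derive_eq (is_derive1_mul (profile_d1 fP y) (profile_d1 fP y))).
    by ring.
  by apply: continuous_onD; [apply: continuous_on_logp_add|
    apply: continuous_on_logp_sub] => //; exact: hd.
Qed.

End segment.

Lemma logp_primitive c al : 0 < al -> exists K : R -> R,
  forall z : R, al <= z -> is_derive z 1 K (logp c 0 G z).
Proof.
move=> al0; pose g := logp c 0 G.
have cg z : 0 < z -> {for z, continuous g}.
  by move=> z0; exact: continuous_logp (profile_dG fP) z0.
(* Starting at [al / 2] puts every [z >= al], including [al], in the interior, where the primitive
   has a two-sided derivative. *)
exists (fun z => \int[mu]_(x in `[al / 2, z]) g x) => z alz.
have [] := @continuous_FTC1_closed R g (al / 2) z (z + 1).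
- lra.
- by apply: continuous_on_integrable => x /andP[xl _]; apply: cg; lra.
- lra.
- by apply: cg; lra.
move=> dK Kz; apply: DeriveDef; first exact: dK.
by rewrite -derive1E; exact: Kz.
Qed.

(** As a function of [h], the left side has derivative [G (c + ln (be + h)) - G (c + ln (al + h))].
    The two arguments stay within one period, so this is at most [e]; the mean value theorem
    concludes. *)
Lemma logp_shift c al be h (K : R -> R) : 0 < al -> al <= be -> 0 < h ->
  ln be <= ln al + P ->
  (forall z : R, al <= z -> is_derive z 1 K (logp c 0 G z)) ->
  (K (be + h) - K be) - (K (al + h) - K al) <= h * e.
Proof.
move=> al0 albe h0 lnP dK.
have d (z x : R) : al <= z -> 0 <= x ->
    is_derive x 1 (fun x => K (z + x)) (logp c 0 G (z + x)).
  move=> alz x0; have zx : al <= z + x by lra.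
  by apply: (is_derive_eq (is_derive1_chain (dK _ zx) (is_derive_addr z x))); rewrite mulr1.
pose F x := K (be + x) - K (al + x).
have dF (x : R) : 0 <= x -> is_derive x 1 F (logp c 0 G (be + x) - logp c 0 G (al + x)).
  by move=> x0; apply: is_derive1_sub; apply: d.
have [x||x] := @MVT _ F (fun x => logp c 0 G (be + x) - logp c 0 G (al + x)) 0 h h0.
- by rewrite in_itv /= => /andP[x0 _]; apply: dF; exact: ltW.
- apply: (@is_derive1_within _ F _ _) => x /=; rewrite in_itv /= => /andP[+ _].
  exact: dF.
rewrite in_itv /= => /andP[x0 _].
rewrite /F !addr0 subr0 => FE.
have : logp c 0 G (be + x) - logp c 0 G (al + x) <= e.
  rewrite /logp !expr0 !divr1; apply: profile_G_le_energy.
  (* A common shift by [x] narrows the logarithmic gap: [(be + x) / be <= (al + x) / al] because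
     [al <= be]. *)
  rewrite -addrA lerD2l; apply: le_trans (_ : ln be + (ln (al + x) - ln al) <= _).
    have be0 : 0 < be by exact: lt_le_trans albe.
    rewrite -lerBlDl -!ln_div ?posrE ?addr_gt0// ler_ln ?posrE ?divr_gt0 ?addr_gt0//.
    rewrite !mulrDl !divff ?gt_eqF// lerD2l ler_wpM2l ?(ltW x0)//.
    by rewrite lef_pV2 ?posrE.
  lra.
move=> lee.
have -> : K (be + h) - K be - (K (al + h) - K al) =
    K (be + h) - K (al + h) - (K be - K al) by ring.
by rewrite FE mulrC ler_wpM2l// ltW.
Qed.

Lemma ln_diff_bounds (al z z' : R) : 0 < al -> al <= z -> z <= z' ->
  0 <= ln z' - ln z <= (z' - z) / al.
Proof.
move=> al0 alz zz'; have z0 : 0 < z by exact: lt_le_trans alz.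
have z'0 : 0 < z' by exact: lt_le_trans zz'.
rewrite subr_ge0 ler_ln ?posrE// zz' -ln_div ?posrE//=.
have -> : z' / z = 1 + (z' - z) / z by rewrite mulrBl divff ?gt_eqF// addrCA subrr addr0.
have u0 : 0 <= (z' - z) / z by rewrite divr_ge0 ?subr_ge0// ltW.
apply: le_trans (le_ln1Dx (lt_le_trans _ u0)) _; first by rewrite oppr_lt0.
by rewrite ler_wpM2l ?subr_ge0// lef_pV2 ?posrE.
Qed.

(** The sign [v] covers both travelling waves; [al] and [be] are the extreme values of [t + v x] on
    the segment. Pointwise, [D^2] is at most the increment of [G] times that of the logarithm. The
    latter is at most [(s - t) / al], and the former integrates to at most [(s - t) e] by
    [logp_shift]. *)
Lemma ip_logp_diff (v c t s a b al be : R) : a < b -> t < s ->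
  0 < al -> al <= be -> ln be <= ln al + P ->
  v = 1 /\ t + a = al /\ t + b = be \/ v = -1 /\ t - b = al /\ t - a = be ->
  let D x := logp c 0 f (s + v * x) - logp c 0 f (t + v * x) in
  continuous_on a b D /\ ip mu `]a, b[ D D <= (s - t) ^+ 2 * (e / al).
Proof.
move=> ab ts al0 albe lnP vE D.
have vv : v * v = 1 by case: vE => -[-> _]; rewrite ?mulrNN mulr1.
have [K dK] := logp_primitive c al0.
have tv (x : R) : a <= x <= b -> al <= t + v * x.
  by move=> /andP[ax xb]; case: vE => -[-> [h1 h2]]; lra.
have cd (q : R) (h dh : R -> R) : t <= q -> (forall y : R, is_derive y 1 h (dh y)) ->
    continuous_on a b (fun x => logp c 0 h (q + v * x)).
  move=> tq hd x /tv atx.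
  have q0 : 0 < q + v * x by lra.
  apply: is_derive1_continuous.
  exact: (@is_derive1_chain _ (logp c 0 h) (fun x => q + v * x) x _ _
    (is_derive_logp c 0 q0 hd) (is_derive_affine v q x)).
have cD : continuous_on a b D.
  by apply: continuous_onB; apply: cd (profile_d fP) => //; exact: ltW.
split=> //.
pose g x := logp c 0 G (s + v * x) - logp c 0 G (t + v * x).
have cg : continuous_on a b g.
  by apply: continuous_onB; apply: cd (profile_dG fP) => //; exact: ltW.
have lD := continuous_on_sqintegrable cD.
have mD : measurable (`]a, b[ : set (measurableTypeR R)) by exact: measurable_itv.
have ig : mu.-integrable `]a, b[ (EFin \o g).
  by apply: integrableS (continuous_on_integrable cg) => //; exact: subset_itv_oo_cc.
have gI : \int[mu]_(x in `]a, b[) g x <= (s - t) * e.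
  (* The factor [v] compensates the inner derivative. For [v = -1] the end points exchange roles, so
     in both cases this is the increment of [K] from [be] minus that from [al]. *)
  apply: (@le_trans _ _ ((v * K (s + v * b) - v * K (t + v * b)) -
      (v * K (s + v * a) - v * K (t + v * a)))); last first.
    have := logp_shift al0 albe _ lnP dK (h := s - t).
    rewrite subr_gt0 => /(_ ts).
    have sh y : t + y + (s - t) = s + y by ring.
    by case: vE => -[-> [<- <-]]; rewrite ?mul1r ?mulN1r !sh; lra.
  rewrite le_eqVlt; apply/orP; left; apply/eqP.
  apply: (@Rintegral_FTC R a b (fun x => v * K (s + v * x) - v * K (t + v * x)) g) => //.
  move=> x /tv atx.
  have d (q : R) : t <= q ->
      is_derive x 1 (fun x => v * K (q + v * x)) (logp c 0 G (q + v * x)).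
    move=> tq; have q0 : al <= q + v * x by lra.
    apply: (is_derive_eq (is_derive1_scale v (@is_derive1_chain _ K
      (fun x => q + v * x) x _ _ (dK _ q0) (is_derive_affine v q x)))).
    by rewrite mulrCA vv mulr1.
  by apply: is_derive1_sub; apply: d => //; exact: ltW.
apply: (@le_trans _ _ (\int[mu]_(x in `]a, b[) ((s - t) / al * g x))).
  apply: le_Rintegral => //; first exact: integrableM.
    exact: integrable_EFinZ.
  move=> x; rewrite /= in_itv /= => /andP[/ltW ax /ltW xb].
  have atx := tv x; rewrite ax xb in atx; have {}atx := atx isT.
  have /(ln_diff_bounds al0 atx) /andP[ln0 lnle] : t + v * x <= s + v * x.
    by rewrite lerD2r ltW.
  rewrite /D /g /logp !expr0 !divr1 -expr2.
  have yy : c + ln (t + v * x) <= c + ln (s + v * x) by rewrite lerD2l -subr_ge0.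
  apply: le_trans (is_derive1_Jensen yy (profile_d fP) (profile_dG fP)) _.
  rewrite mulrC ler_wpM2r ?subr_ge0 ?profile_G_le//.
  have sh (y y' q : R) : q + y - (q + y') = y - y' by ring.
  by move: lnle; rewrite !sh (_ : s + v * x - (t + v * x) = s - t)//; ring.
rewrite RintegralZl//.
have : (s - t) / al * (\int[mu]_(x in `]a, b[) g x) <= (s - t) / al * ((s - t) * e).
  by rewrite ler_wpM2l// divr_ge0 ?subr_ge0// ltW.
by move/le_trans; apply; rewrite expr2 le_eqVlt; apply/orP; left; apply/eqP; ring.
Qed.

End profile_theory.

(** * The moving interval *)

Section moving_interval.
Context {R : realType}.
Notation mu := (@lebesgue_measure R).
Variables (l1 l2 : R).
Hypotheses (l10 : 0 <= l1) (l11 : l1 < 1) (l20 : 0 <= l2) (l21 : l2 < 1)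
  (l12 : 0 < l1 + l2).

Definition period : R := ln (alpha_l l1 l2 * beta_l l1 l2).
Definition delay : R := ln ((1 + l2) / (1 - l2)).

Let p1 : 0 < 1 + l1. Proof. by move: l10; lra. Qed.
Let m1 : 0 < 1 - l1. Proof. by move: l11; lra. Qed.
Let p2 : 0 < 1 + l2. Proof. by move: l20; lra. Qed.
Let m2 : 0 < 1 - l2. Proof. by move: l21; lra. Qed.

Lemma delayE : delay = ln (1 + l2) - ln (1 - l2).
Proof. by rewrite /delay ln_div ?posrE. Qed.

Lemma periodE : period =
  (ln (1 + l1) - ln (1 - l2)) + (ln (1 + l2) - ln (1 - l1)).
Proof.
by rewrite /period /alpha_l /beta_l lnM ?posrE ?divr_gt0// !ln_div ?posrE.
Qed.

Let lnp1 : 0 <= ln (1 + l1). Proof. by apply: ln_ge0; move: l10; lra. Qed.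
Let lnm1 : ln (1 - l1) <= 0. Proof. by apply: ln_le0; move: l10; lra. Qed.
Let lnp2 : 0 <= ln (1 + l2). Proof. by apply: ln_ge0; move: l20; lra. Qed.
Let lnm2 : ln (1 - l2) <= 0. Proof. by apply: ln_le0; move: l20; lra. Qed.

Lemma period_gt0 : 0 < period.
Proof.
rewrite periodE; have [l1p|l1n] := ltP 0 l1.
  have : 0 < ln (1 + l1) by apply: ln_gt0; lra.
  by move: lnm1 lnp2 lnm2; lra.
have : 0 < ln (1 + l2) by apply: ln_gt0; move: l12; lra.
by move: lnm1 lnp1 lnm2; lra.
Qed.

Section time.
Variable t : R.
Hypothesis t0 : 0 < t.
Let a := - (l1 * t).
Let b := l2 * t.

Lemma Iat_lt : a < b.
Proof. by rewrite /a /b -subr_gt0 opprK -mulrDl mulr_gt0// addrC. Qed.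

Lemma Iat_add_gt0 : 0 < t + a.
Proof. by rewrite /a -{1}(mul1r t) -mulrBl mulr_gt0. Qed.

Lemma Iat_sub_gt0 : 0 < t - b.
Proof. by rewrite /b -{1}(mul1r t) -mulrBl mulr_gt0. Qed.

Let lnta : ln (t + a) = ln t + ln (1 - l1).
Proof. by rewrite -lnM ?posrE// mulrBr mulr1 mulrC. Qed.
Let lntb : ln (t + b) = ln t + ln (1 + l2).
Proof. by rewrite -lnM ?posrE// mulrDr mulr1 mulrC. Qed.
Let lntNa : ln (t - a) = ln t + ln (1 + l1).
Proof. by rewrite -lnM ?posrE// mulrDr mulr1 mulrC /a opprK. Qed.
Let lntNb : ln (t - b) = ln t + ln (1 - l2).
Proof. by rewrite -lnM ?posrE// mulrBr mulr1 mulrC. Qed.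

(** This and the next identity give the boundary conditions for periodic profiles, and they make the
    two logarithms together sweep exactly one period. *)
Lemma ln_right_end : delay + ln (t - b) = ln (t + b).
Proof. by rewrite lntNb lntb delayE; ring. Qed.

Lemma ln_left_end : delay + ln (t - a) = ln (t + a) + period.
Proof. by rewrite lntNa lnta delayE periodE; ring. Qed.

(** The period is the sum of the logarithmic widths of [t + x] and [t - x]. Both are nonnegative, so
    each wave separately sweeps at most one period. *)
Lemma ln_width_add : ln (t + b) <= ln (t + a) + period.
Proof. by rewrite lntb lnta periodE; move: lnp1 lnm2; lra. Qed.

Lemma ln_width_sub : ln (t - a) <= ln (t - b) + period.
Proof. by rewrite lntNb lntNa periodE; move: lnp2 lnm1; lra. Qed.

(** One logarithm increases and the other decreases in [x]; they meet at the right end and are one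
    period apart at the left end. *)
Lemma ln_inner x : a <= x <= b ->
  ln (t + x) <= delay + ln (t - x) <= ln (t + x) + period.
Proof.
move=> /andP[ax xb]; have ta := Iat_add_gt0; have tb := Iat_sub_gt0.
have h1 : ln (t + a) <= ln (t + x) by rewrite ler_ln ?posrE; lra.
have h2 : ln (t + x) <= ln (t + b) by rewrite ler_ln ?posrE; lra.
have h3 : ln (t - b) <= ln (t - x) by rewrite ler_ln ?posrE; lra.
have h4 : ln (t - x) <= ln (t - a) by rewrite ler_ln ?posrE; lra.
by have := ln_left_end; have := ln_right_end; lra.
Qed.

Variables (e : R) (f f1 f2 f3 G : R -> R).
Hypothesis fP : profile period e f f1 f2 f3 G.

Lemma wave_left_end : wave delay f t a = 0.
Proof. by rewrite waveE ln_left_end (profile_period fP) subrr. Qed.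

Lemma wave_right_end : wave delay f t b = 0.
Proof. by rewrite waveE ln_right_end subrr. Qed.

(** The wave is an increment of [f] over at most one period. The bound sees only the energy, so it
    is uniform in time and in the number of modes. *)
Lemma wave_bounded x : a <= x <= b -> `|wave delay f t x| <= Num.sqrt (e * period).
Proof.
move=> /ln_inner /andP[h1 h2].
have e0 := profile_energy_ge0 fP period_gt0; have P0 := ltW period_gt0.
rewrite -(ler_pXn2r (n := 2)) ?nnegrE ?sqrtr_ge0// sqr_sqrtr ?mulr_ge0//.
rewrite real_normK ?num_real// waveE -sqrrN opprB.
apply: le_trans (profile_Jensen fP h1 h2) _.
by rewrite ler_wpM2l// lerBlDl.
Qed.

Lemma quad_wave_energy :
  quad t `]a, b[ (wavex delay f1 t) (wavet delay f1 t) = e.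
Proof.
rewrite (quad_wave fP) ?Iat_lt ?Iat_add_gt0 ?Iat_sub_gt0//.
rewrite !waveE ln_right_end ln_left_end (profile_periodG fP); ring.
Qed.

(** The bound depends neither on [s] nor, except through [e], on the profile. The constants come
    from [ip_logp_diff] for each wave, with [al = t + a] and [al = t - b], and from
    [(u - v)^2 <= 2 u^2 + 2 v^2]. *)
Lemma ip_wave_diff s : t < s ->
  let D x := (s - t)^-1 * (wave delay f s x - wave delay f t x) in
  continuous_on a b D /\
  ip mu `]a, b[ D D <= (2 / (t + a) + 2 / (t - b)) * e.
Proof.
move=> ts.
have [c1 i1] := ip_logp_diff fP 0 Iat_lt ts Iat_add_gt0
  (lerD (lexx t) (ltW Iat_lt)) ln_width_add
  (or_introl (conj erefl (conj erefl erefl))).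
have tbta : t - b <= t - a by rewrite lerD2l lerN2 ltW ?Iat_lt.
have [c2 i2] := ip_logp_diff fP delay Iat_lt ts Iat_sub_gt0
  tbta ln_width_sub
  (or_intror (conj erefl (conj erefl erefl))).
set D1 := fun x => _ in c1 i1; set D2 := fun x => _ in c2 i2.
move=> D.
have DE : D = fun x => (s - t)^-1 * (D1 x - D2 x).
  apply/funext => x; rewrite /D /D1 /D2 /wave !mul1r !mulN1r; congr (_ * _); ring.
have st0 : s - t != 0 by rewrite subr_eq0 gt_eqF.
split.
  rewrite DE; apply: continuous_onM; last exact: continuous_onB.
  by move=> x _; exact: cvg_cst.
have mD : measurable (`]a, b[ : set (measurableTypeR R)) by exact: measurable_itv.
have l1' := continuous_on_sqintegrable c1; have l2' := continuous_on_sqintegrable c2.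
have lB := sqintegrableB mD l1' l2'.
rewrite DE ipZl// ?ipZr//; last exact: sqintegrableZ.
have : ip mu `]a, b[ (fun x => D1 x - D2 x) (fun x => D1 x - D2 x) <=
   (s - t) ^+ 2 * ((2 / (t + a) + 2 / (t - b)) * e).
  apply: le_trans (ip_sub_le mD l1' l2') _.
  by apply: le_trans (lerD (ler_wpM2l _ i1) (ler_wpM2l _ i2)) _ => //; lra.
rewrite mulrA -expr2 exprVn => h.
by rewrite ler_pdivrMl// exprn_gt0// subr_gt0.
Qed.

End time.
End moving_interval.

Lemma trig_profile (R : realType) (w : R) (p q : nat -> R) m n : 0 < w ->
  exists G, profile (2 * pi / w)
    (2 * pi / w / 2 *
      \sum_(m.+1 <= k < n.+1) (dcos w q k ^+ 2 + dsin w p k ^+ 2))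
    (trig w p q m n) (trig w (dcos w q) (dsin w p) m n)
    (trig w (dcos w (dsin w p)) (dsin w (dcos w q)) m n)
    (trig w (dcos w (dsin w (dcos w q))) (dsin w (dcos w (dsin w p))) m n) G.
Proof.
move=> w0; have [G [dG GP]] := period_integral_trig_sqr w0 (dcos w q) (dsin w p) m n.
exists G; split => //; try by move=> y; exact: is_derive_trig.
- exact: trig_bounded.
- exact: trig_bounded.
- by move=> y; exact: trig_period.
Qed.

(** * Comparison of the quadratic form with the energy *)

Section quad_bounds.
Context {R : realType}.
Notation mu := (@lebesgue_measure R).
Variables (l1 l2 t : R).
Hypothesis t0 : 0 < t.
Notation D := (Iat l1 l2 t).
Notation L := (L_l l1 l2).
Variables (u v : R -> R).
Hypotheses (lu : sqintegrable mu D u) (lv : sqintegrable mu D v).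

Lemma measurable_Iat : measurable (D : set (measurableTypeR R)).
Proof. exact: measurable_itv. Qed.
Let mD := measurable_Iat.

Lemma Iat_norm_le x : D x -> `|x| <= L * t.
Proof.
rewrite /Iat /= in_itv /= => /andP[ax xb].
have m1 : l1 * t <= L * t by rewrite ler_wpM2r ?(ltW t0)// le_max lexx.
have m2 : l2 * t <= L * t by rewrite ler_wpM2r ?(ltW t0)// le_max lexx orbT.
by rewrite ler_norml; apply/andP; split; lra.
Qed.

Lemma sqintegrable_idM : sqintegrable mu D (fun x => x * u x).
Proof.
apply: (@sqintegrableM _ _ _ mu D mD id u (L * t)) => //.
by move=> x; exact: Iat_norm_le.
Qed.

Lemma ip_idM_le : `|ip mu D (fun x => x * u x) v| <=
  L * t / 2 * (ip mu D u u + ip mu D v v).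
Proof.
have amgm (y z : R) : `|y * z| <= 2^-1 * (y * y + z * z).
  have := sqr_ge0 (y - z); have := sqr_ge0 (y + z).
  by rewrite ler_norml => h1 h2; apply/andP; split; lra.
have ixuv := integrableM mD sqintegrable_idM lv.
have iuu := integrableM mD lu lu; have ivv := integrableM mD lv lv.
apply: le_trans (le_normr_Rintegral mD ixuv) _.
rewrite /ip -RintegralD// -RintegralZl//; last exact: integrable_EFinD.
apply: le_Rintegral => //.
- exact: integrable_norm.
- by apply: integrable_EFinZ => //; exact: integrable_EFinD.
move=> x /Iat_norm_le xL; rewrite -mulrA normrM -mulrA.
by apply: ler_pM => //; exact: amgm.
Qed.

(** On the interval [|x| <= L t], so the mixed term is at most [L t] times the energy. As [L < 1] in
    the applications, this is coercivity: it gives the upper bound on [E] in the theorem and also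
    controls the derivatives of remainders. *)
Lemma quad_lower : t * (1 - L) / 2 * (ip mu D u u + ip mu D v v) <= quad t D u v.
Proof.
have := ip_idM_le; rewrite ler_norml /quad => /andP[h _].
move: h; set A := ip mu D u u + _; set B := ip mu D _ v; lra.
Qed.

Lemma quad_upper : quad t D u v <= t * (1 + L) / 2 * (ip mu D u u + ip mu D v v).
Proof.
have := ip_idM_le; rewrite ler_norml /quad => /andP[_ h].
move: h; set A := ip mu D u u + _; set B := ip mu D _ v; lra.
Qed.

End quad_bounds.

(** * Convergence of the partial sums *)

Lemma is_derive1_quotient_cvg (R : realType) (g : R -> R) (t d : R) (s : R^nat) :
  is_derive t 1 g d -> s @ \oo --> t -> (forall j, s j != t) ->
  (s j - t)^-1 * (g (s j) - g t) @[j --> \oo] --> d.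
Proof.
move=> /is_derive1_caratheodory[h [hE ch <-]] st sNt.
have -> : (fun j => (s j - t)^-1 * (g (s j) - g t)) = h \o s.
  apply/funext => j /=; rewrite hE mulrCA mulVf ?mulr1//.
  by rewrite subr_eq0.
by apply: continuous_cvg.
Qed.

Lemma is_derive1_Lipschitz (R : realType) (f df : R -> R) (C x y : R) :
  (forall z : R, is_derive z 1 f (df z)) -> (forall z, `|df z| <= C) ->
  x <= y -> `|f y - f x| <= C * (y - x).
Proof.
move=> hf dfC xy.
have lin (z : R) : is_derive z 1 (fun z => C * z) C.
  by have := is_derive1_scale C (is_derive_id z 1); rewrite mulr1.
have h1 := is_derive1_mono xy (fun z => is_derive1_sub (lin z) (hf z)).
have h2 := is_derive1_mono xy (fun z => is_derive1_add (lin z) (hf z)).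
have dz z : 0 <= C - df z /\ 0 <= C + df z.
  by have := dfC z; rewrite ler_norml => /andP[? ?]; split; lra.
have {}h1 := h1 (fun z => (dz z).1); have {}h2 := h2 (fun z => (dz z).2).
by rewrite ler_norml; apply/andP; split; lra.
Qed.

Section convergence_of_modes.
Context {R : realType}.
Notation mu := (@lebesgue_measure R).
Variables (l1 l2 : R).
Hypotheses (l10 : 0 <= l1) (l11 : l1 < 1) (l20 : 0 <= l2) (l21 : l2 < 1)
  (l12 : 0 < l1 + l2).
Notation D t := (Iat l1 l2 t).
Notation L := (L_l l1 l2).
Notation gam := (delay l2).

Variables (w : R) (p q : nat -> R).
Hypotheses (w0 : 0 < w) (wE : 2 * pi / w = period l1 l2).

Definition trig_energy m n : R := period l1 l2 / 2 *
  \sum_(m.+1 <= k < n.+1) (dcos w q k ^+ 2 + dsin w p k ^+ 2).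

Local Notation F m n := (trig w p q m n).
Local Notation F1 m n := (trig w (dcos w q) (dsin w p) m n).
Local Notation F2 m n := (trig w (dcos w (dsin w p)) (dsin w (dcos w q)) m n).

Lemma trig_profileE m n :
  exists f3 G, profile (period l1 l2) (trig_energy m n) (F m n) (F1 m n) (F2 m n) f3 G.
Proof.
have [G hG] := trig_profile p q m n w0.
by rewrite wE in hG; exists (trig w (dcos w (dsin w (dcos w q)))
  (dsin w (dcos w (dsin w p))) m n), G.
Qed.

Lemma wave_sub c m n t x : (m <= n)%N ->
  wave c (F 0 n) t x - wave c (F 0 m) t x = wave c (F m n) t x.
Proof. by move=> mn; rewrite !waveE -!(trig_sub _ _ _ _ mn); ring. Qed.

Lemma trig_energy_sub m n : (m <= n)%N ->
  trig_energy m n = trig_energy 0 n - trig_energy 0 m.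
Proof.
move=> mn; rewrite /trig_energy (@big_cat_nat _ _ _ m.+1 1)//=; ring.
Qed.

Lemma trig_energy_ge0 m n : 0 <= trig_energy m n.
Proof.
have [f3 [G hp]] := trig_profileE m n.
exact: (profile_energy_ge0 hp (period_gt0 l10 l11 l20 l21 l12)).
Qed.

Lemma trig_energy_nondecreasing : nondecreasing_seq (trig_energy 0).
Proof.
by apply/nondecreasing_seqP => k; rewrite -subr_ge0 -trig_energy_sub// trig_energy_ge0.
Qed.

Variable S : R.
Hypothesis energyS : trig_energy 0 n @[n --> \oo] --> S.

Let eps m := S - trig_energy 0 m.

Lemma eps_cvg0 : eps @ \oo --> (0 : R).
Proof. by rewrite -(subrr S); apply: cvgB => //; exact: cvg_cst. Qed.

Lemma trig_energy_le_eps m n : (m <= n)%N -> trig_energy m n <= eps m.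
Proof.
move=> mn; rewrite trig_energy_sub// lerD2r.
have cS : cvgn (trig_energy 0) by apply/cvg_ex; exists S.
rewrite -(cvg_lim _ energyS)//.
exact: nondecreasing_cvgn_le trig_energy_nondecreasing _ _.
Qed.

Variables (t : R) (phi : R -> R -> R).
Hypothesis t0 : 0 < t.
Hypothesis sqphi : forall s, t <= s -> sqintegrable mu (D s) (phi ^~ s).
Hypothesis phi_series : forall s, t <= s -> {ae mu, forall x, D s x ->
  wave gam (F 0 n) s x @[n --> \oo] --> phi x s}.

Let a := - (l1 * t).
Let b := l2 * t.
Let ab : a < b := Iat_lt l12 t0.
Let ta : 0 < t + a := Iat_add_gt0 l11 t0.
Let tb : 0 < t - b := Iat_sub_gt0 l21 t0.
Let mD : measurable (D t : set (measurableTypeR R)) := measurable_itv _.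

Lemma Iat_mono s : t <= s -> D t `<=` D s.
Proof.
move=> ts x; rewrite /Iat /= !in_itv /= => /andP[ax xb]; apply/andP; split.
  by apply: le_lt_trans ax; rewrite lerN2 ler_wpM2l.
by apply: lt_le_trans xb _; rewrite ler_wpM2l.
Qed.

Lemma Iat_closed x : D t x -> a <= x <= b.
Proof. by rewrite /Iat /= in_itv /= => /andP[/ltW -> /ltW ->]. Qed.

Lemma sqintegrable_Iat (u : R -> R) : continuous_on a b u -> sqintegrable mu (D t) u.
Proof. exact: continuous_on_sqintegrable. Qed.

Lemma sqintegrable_phi s : t <= s -> sqintegrable mu (D t) (phi ^~ s).
Proof.
move=> ts; have [m i] := sqphi ts; split.
  by apply: measurable_funS m; [exact: measurable_itv|exact: Iat_mono].
by apply: integrableS i; [exact: measurable_itv|exact: mD|exact: Iat_mono].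
Qed.

Lemma continuous_on_wave_later s m n : t <= s ->
  continuous_on a b (wave gam (F m n) s).
Proof.
move=> ts; have [f3 [G hp]] := trig_profileE m n.
by apply: (continuous_on_wave (c := gam) hp); [move: ta|move: tb]; lra.
Qed.

Lemma wave_cvg_l2 s : t <= s ->
  cvg_l2 mu (D t) (fun n => wave gam (F 0 n) s) (phi ^~ s).
Proof.
move=> ts.
apply: (@bounded_cvg_l2 _ _ _ mu (D t) mD _ _ (Num.sqrt (S * period l1 l2))).
- exact: itv_oo_lty.
- by move=> n; have [] := sqintegrable_Iat (continuous_on_wave_later (m := 0%N) (n := n) ts).
- move=> n x Dx; have [f3 [G hp]] := trig_profileE 0 n.
  have s0 : 0 < s by exact: lt_le_trans ts.
  have := Iat_mono ts Dx; rewrite /Iat /= in_itv /= => /andP[/ltW sa /ltW sb].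
  apply: (le_trans (wave_bounded l10 l11 l20 l21 l12 s0 hp (x := x) _)).
    by rewrite sa.
  apply: ler_wsqrtr; rewrite ler_wpM2r ?(ltW (period_gt0 l10 l11 l20 l21 l12))//.
  (* [eps 0] is [S], since the empty block of modes has energy 0. *)
  apply: le_trans (trig_energy_le_eps (leq0n n)) _.
  by rewrite /eps /trig_energy big_geq// mulr0 subr0.
- exact: sqintegrable_phi.
- have [N [mN N0 NP]] := phi_series ts; exists N; split=> //.
  apply: subset_trans NP; apply: subsetC => x h Dx; apply: h.
  exact: (Iat_mono ts Dx).
Qed.

Let L1 : L < 1. Proof. by rewrite /L_l gt_max l11 l21. Qed.

(** The inverse of the coercivity constant in [quad_lower]. *)
Let C1 : R := 2 / (t * (1 - L)).
Let C10 : 0 <= C1.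
Proof. by rewrite /C1 divr_ge0// mulr_ge0 ?subr_ge0 ?ltW. Qed.

Lemma ip_waves_le m n :
  ip mu (D t) (wavex gam (F1 m n) t) (wavex gam (F1 m n) t) +
  ip mu (D t) (wavet gam (F1 m n) t) (wavet gam (F1 m n) t) <=
  C1 * trig_energy m n.
Proof.
have [f3 [G hp]] := trig_profileE m n.
have cx := continuous_on_wavex (c := gam) hp ta tb.
have ct := continuous_on_wavet (c := gam) hp ta tb.
have := quad_lower t0 (sqintegrable_Iat cx) (sqintegrable_Iat ct).
rewrite (quad_wave_energy l10 l11 l20 l21 l12 t0 hp) => h.
have C0 : 0 < t * (1 - L) by rewrite mulr_gt0// subr_gt0.
by rewrite /C1 mulrAC ler_pdivlMr//; move: h; lra.
Qed.

(* The error [r = phix - wavex_N] is tested against [psi_k = w_k' - wavex_N],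
   which tends to [r]; integrating by parts twice replaces [r] in the pairing
   by the limit of [wavex_M - wavex_N], whose norm is controlled by the energy
   of the modes above [N]. *)
Lemma wavex_cvg_l2 (phix : R -> R) (wk : (R -> R)^nat) :
  (forall k, test_function (D t) (wk k)) ->
  cvg_l2 mu (D t) wk (phi ^~ t) ->
  cvg_l2 mu (D t) (fun k => derive1 (wk k)) phix ->
  cvg_l2 mu (D t) (fun n => wavex gam (F1 0 n) t) phix.
Proof.
move=> twk cwk cdwk; have [_ lphix _] := cdwk.
have dwk k (n : nat) (x : R) : is_derive x 1 (derive1n n (wk k)) (derive1n n.+1 (wk k) x).
  by apply: DeriveDef; [exact: (twk k).1|rewrite derive1nS derive1E].
have wk_end k x : ~ D t x -> wk k x = 0.
  by have [_ [K [_ KD K0]]] := twk k; move=> Dx; apply: K0 => /KD.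
have aD : ~ D t a by rewrite /Iat /= in_itv /= ltxx.
have bD : ~ D t b by rewrite /Iat /= in_itv /= ltxx andbF.
have cwkn k n : continuous_on a b (derive1n n (wk k)).
  by move=> x _; exact: is_derive1_continuous (dwk k n x).
apply: (@cvg_l2_le _ _ _ mu (D t) _ _ (fun n => C1 * eps n)).
- move=> n; have [f3 [G hp]] := trig_profileE 0 n.
  exact: sqintegrable_Iat (continuous_on_wavex (c := gam) hp ta tb).
- exact: lphix.
- by rewrite -(mulr0 C1); apply: cvgM; [exact: cvg_cst|exact: eps_cvg0].
move=> N; have [f3 [G hp]] := trig_profileE 0 N.
rewrite ip_subC.
have ld : forall x, a <= x <= b -> 0 < t + x /\ 0 < t - x.
  by move=> x /andP[ax xb]; move: ta tb; split; lra.
have cx := continuous_on_wavex (c := gam) hp ta tb.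
have cxx := continuous_on_wavexx (c := gam) hp ta tb.
set vx := wavex gam (F1 0 N) t in cx *.
set vxx := wavexx _ _ _ in cxx.
pose psi k x := derive1 (wk k) x - vx x.
pose dpsi k x := derive1n 2 (wk k) x - vxx x.
have cpsi k : continuous_on a b (psi k).
  by apply: continuous_onB => //; exact: (cwkn k 1).
have cdpsi k : continuous_on a b (dpsi k).
  by apply: continuous_onB => //; exact: (cwkn k 2).
have psid k (x : R) : a <= x <= b -> is_derive x 1 (psi k) (dpsi k x).
  move=> /ld[h1 h2]; apply: is_derive1_sub; first exact: (dwk k 1).
  exact: is_derive_wavex (profile_d1 hp) h1 h2.
pose u k x := wk k x - wave gam (F 0 N) t x.
have parts j k : ip mu (D t) (psi j) (psi k) = - ip mu (D t) (u j) (dpsi k).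
  apply: ip_by_parts => //; try exact: psid.
  - by rewrite /u wk_end// (wave_left_end l10 l11 l20 l21 t0 hp) subrr.
  - by rewrite /u wk_end// (wave_right_end l20 l21 t0) subrr.
  - move=> x /ld[h1 h2]; apply: is_derive1_sub; first exact: (dwk j 0).
    exact: is_derive_wave (profile_d hp) h1 h2.
pose r x := phix x - vx x.
pose z x := phi x t - wave gam (F 0 N) t x.
have lpsi k := sqintegrable_Iat (cpsi k).
have ldpsi k := sqintegrable_Iat (cdpsi k).
have lr : sqintegrable mu (D t) r := sqintegrableB mD lphix (sqintegrable_Iat cx).
have lw := sqintegrable_Iat (continuous_on_wave_later (m := 0%N) (n := N) (lexx t)).
have cpsir : cvg_l2 mu (D t) psi r.
  exact: (cvg_l2B mD cdwk (cvg_l2_cst mD (sqintegrable_Iat cx))).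
have lz : cvg_l2 mu (D t) u z.
  exact: (cvg_l2B mD cwk (cvg_l2_cst mD lw)).
(* First integration by parts, done on [psi j] and then passed to the limit in [j]. The boundary
   terms vanish because both [wk j] and the wave are 0 at the ends. *)
have rpsi k : ip mu (D t) r (psi k) = - ip mu (D t) z (dpsi k).
  have h1 : ip mu (D t) (psi j) (psi k) @[j --> \oo] --> ip mu (D t) r (psi k).
    exact: (cvg_l2_ip mD cpsir (cvg_l2_cst mD (lpsi k))).
  have h2 : ip mu (D t) (u j) (dpsi k) @[j --> \oo] --> ip mu (D t) z (dpsi k).
    exact: (cvg_l2_ip mD lz (cvg_l2_cst mD (ldpsi k))).
  have e : (fun j => ip mu (D t) (psi j) (psi k)) =
      (fun j => - ip mu (D t) (u j) (dpsi k)) by apply/funext => j; exact: parts.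
  by rewrite e in h1; exact: (cvg_unique _ h1 (cvgN h2)).
(* Second integration by parts, in the opposite direction. [z] is the L^2 limit of the waves made of
   the modes between [N] and [M], whose x-derivatives are bounded by [C1 * eps N] for all [M]. *)
have zle k : ip mu (D t) z (dpsi k) ^+ 2 <= C1 * eps N * ip mu (D t) (psi k) (psi k).
  pose y M x := wave gam (F 0 M) t x - wave gam (F 0 N) t x.
  have cy : cvg_l2 mu (D t) y z.
    exact: (cvg_l2B mD (wave_cvg_l2 (lexx t)) (cvg_l2_cst mD lw)).
  have h : ip mu (D t) (y M) (dpsi k) ^+ 2 @[M --> \oo] --> ip mu (D t) z (dpsi k) ^+ 2.
    have h2 : ip mu (D t) (y M) (dpsi k) @[M --> \oo] --> ip mu (D t) z (dpsi k).
      exact: (cvg_l2_ip mD cy (cvg_l2_cst mD (ldpsi k))).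
    by have h3 := cvgM h2 h2; exact: h3.
  apply: (ler_cvg_to h (cvg_cst _)).
  near=> M.
  have NM : (N <= M)%N by near: M; exact: nbhs_infty_ge.
  have [g3 [G' hq]] := trig_profileE N M.
  have -> : y M = wave gam (F N M) t by apply/funext => x; rewrite /y wave_sub.
  have cq := continuous_on_wavex (c := gam) hq ta tb.
  have -> : ip mu (D t) (wave gam (F N M) t) (dpsi k) ^+ 2 =
      ip mu (D t) (wavex gam (F1 N M) t) (psi k) ^+ 2.
    rewrite -[RHS]sqrrN; congr (_ ^+ 2); apply: oppr_inj; rewrite opprK.
    apply/esym/ip_by_parts => //; try exact: psid.
    - by rewrite (wave_left_end l10 l11 l20 l21 t0 hq).
    - by rewrite (wave_right_end l20 l21 t0).
    - by move=> x /ld[h1 h2]; exact: is_derive_wave (profile_d hq) h1 h2.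
  apply: le_trans (Cauchy_Schwarz mD (sqintegrable_Iat cq) (lpsi k)) _.
  rewrite ler_wpM2r ?ip_ge0//.
  apply: le_trans (_ : C1 * trig_energy N M <= _).
    by apply: le_trans (ip_waves_le N M); rewrite lerDl ip_ge0.
  by rewrite ler_wpM2l// trig_energy_le_eps.
(* Letting [k] tend to infinity turns [psi k] into [r]; one factor [ip r r] is then divided out,
   unless it is 0. *)
have rr : ip mu (D t) r r ^+ 2 <= C1 * eps N * ip mu (D t) r r.
  have h1 : ip mu (D t) r (psi k) ^+ 2 @[k --> \oo] --> ip mu (D t) r r ^+ 2.
    have h2 : ip mu (D t) r (psi k) @[k --> \oo] --> ip mu (D t) r r.
      exact: (cvg_l2_ip mD (cvg_l2_cst mD lr) cpsir).
    by have h3 := cvgM h2 h2; exact: h3.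
  have h2 : C1 * eps N * ip mu (D t) (psi k) (psi k) @[k --> \oo] -->
      C1 * eps N * ip mu (D t) r r.
    by apply: cvgM; [exact: cvg_cst|exact: (cvg_l2_ip mD cpsir cpsir)].
  apply: (ler_cvg_to h1 h2); apply: nearW => k.
  by rewrite rpsi sqrrN.
have [->|r0] := eqVneq (ip mu (D t) r r) 0.
  apply: mulr_ge0 => //; apply: le_trans _ (trig_energy_le_eps (leqnn N)).
  exact: trig_energy_ge0.
have {}r0 : 0 < ip mu (D t) r r by rewrite lt_neqAle eq_sym r0 ip_ge0.
by move: rr; rewrite expr2 ler_pM2r.
Unshelve. all: by end_near. Qed.

(** Only times after [t] are used: the intervals expand, so [phi] at a later time is defined on all
    of [D t]. *)
Let step (j : nat) : R := t + j.+1%:R^-1.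

Let step_gt j : t < step j.
Proof. by rewrite /step ltrDl invr_gt0. Qed.

Let step_cvg : step @ \oo --> t.
Proof.
rewrite -[X in _ --> X]addr0; apply: cvgD; first exact: cvg_cst.
exact: cvg_harmonic.
Qed.

(** Here [N] is fixed, so the dominating constant may depend on it, through the sup [C] of the
    derivative of the profile. *)
Lemma wave_quotient_cvg_l2 N : cvg_l2 mu (D t)
  (fun j x => (step j - t)^-1 *
     (wave gam (F 0 N) (step j) x - wave gam (F 0 N) t x))
  (wavet gam (F1 0 N) t).
Proof.
have [f3 [G hp]] := trig_profileE 0 N; have [C fC] := profile_bounded1 hp.
have C0 : 0 <= C by exact: le_trans (normr_ge0 _) (fC 0).
have ct := continuous_on_wavet (c := gam) hp ta tb.
have cq j := (ip_wave_diff l10 l11 l20 l21 l12 t0 hp (step_gt j)).1.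
apply: (@bounded_cvg_l2 _ _ _ mu (D t) mD _ _ (C / (t + a) + C / (t - b))).
- exact: itv_oo_lty.
- by move=> j; have [] := sqintegrable_Iat (cq j).
- move=> j x /Iat_closed/andP[ax xb]; have sj := step_gt j.
  have lip (al z z' c : R) : 0 < al -> al <= z -> z' - z = step j - t ->
      `|F 0 N (c + ln z') - F 0 N (c + ln z)| <= C / al * (step j - t).
    move=> al0 alz zz; have zz' : z <= z' by rewrite -subr_ge0 zz subr_ge0 ltW.
    have /andP[ln0 lnle] := ln_diff_bounds al0 alz zz'.
    have yy : c + ln z <= c + ln z' by rewrite lerD2l -subr_ge0.
    apply: le_trans (is_derive1_Lipschitz (profile_d hp) fC yy) _.
    rewrite -mulrA ler_wpM2l//; move: lnle; rewrite zz mulrC => lnle.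
    by have -> : c + ln z' - (c + ln z) = ln z' - ln z by ring.
  have h1 := lip (t + a) (t + x) (step j + x) 0 ta.
  have h2 := lip (t - b) (t - x) (step j - x) gam tb.
  have st0 : 0 < step j - t by rewrite subr_gt0.
  rewrite normrM normfV (gtr0_norm st0) ler_pdivrMl//.
  have -> : wave gam (F 0 N) (step j) x - wave gam (F 0 N) t x =
     (F 0 N (0 + ln (step j + x)) - F 0 N (0 + ln (t + x))) -
     (F 0 N (gam + ln (step j - x)) - F 0 N (gam + ln (t - x))).
    by rewrite !waveE !add0r; ring.
  apply: le_trans (ler_normB _ _) _; rewrite mulrDr.
  apply: lerD; rewrite mulrC; [apply: h1|apply: h2]; first by rewrite lerD2l.
  + ring.
  + by rewrite lerD2l lerN2.
  + ring.
- exact: sqintegrable_Iat.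
- apply: aeW => x /Iat_closed/andP[ax xb].
  apply: (@is_derive1_quotient_cvg _ (fun s => wave gam (F 0 N) s x)) => //.
  + by apply: is_derive_wavet; [exact: profile_d hp|move: ta; lra|move: tb; lra].
  + by move=> j; rewrite gt_eqF.
Qed.

Let C2 : R := 2 / (t + a) + 2 / (t - b).
Let C20 : 0 <= C2.
Proof. by rewrite /C2 addr_ge0// divr_ge0// ltW. Qed.

(** The order of limits matters. For fixed [j], letting [M] tend to infinity bounds the quotient of
    the remainder after [N] modes by [C2 * eps N], uniformly in [j]. Then [j] tends to infinity, and
    [N] last. *)
Lemma wavet_cvg_l2 (phit : R -> R) :
  cvg_l2 mu (D t) (fun j x => (step j - t)^-1 * (phi x (step j) - phi x t)) phit ->
  cvg_l2 mu (D t) (fun n => wavet gam (F1 0 n) t) phit.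
Proof.
move=> cphit; have [_ lphit _] := cphit.
have lt n : sqintegrable mu (D t) (wavet gam (F1 0 n) t).
  have [f3 [G hp]] := trig_profileE 0 n.
  exact: sqintegrable_Iat (continuous_on_wavet (c := gam) hp ta tb).
apply: (@cvg_l2_le _ _ _ mu (D t) _ _ (fun n => C2 * eps n)) => //.
  by rewrite -(mulr0 C2); apply: cvgM; [exact: cvg_cst|exact: eps_cvg0].
move=> N; rewrite ip_subC.
pose Q n j x := (step j - t)^-1 *
  (wave gam (F 0 n) (step j) x - wave gam (F 0 n) t x).
pose Qphi j x := (step j - t)^-1 * (phi x (step j) - phi x t).
have lQ n j : sqintegrable mu (D t) (Q n j).
  have [f3 [G hp]] := trig_profileE 0 n.
  exact: sqintegrable_Iat (ip_wave_diff l10 l11 l20 l21 l12 t0 hp (step_gt j)).1.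
have cQ j : cvg_l2 mu (D t) (fun M => Q M j) (Qphi j).
  apply: cvg_l2Z => //; apply: (cvg_l2B mD); last exact: wave_cvg_l2.
  by apply: wave_cvg_l2; exact: ltW.
have le j : ip mu (D t) (fun x => Qphi j x - Q N j x) (fun x => Qphi j x - Q N j x) <=
    C2 * eps N.
  have c := cvg_l2B mD (cQ j) (cvg_l2_cst mD (lQ N j)).
  apply: (ler_cvg_to (cvg_l2_ip mD c c) (cvg_cst _)).
  near=> M.
  have NM : (N <= M)%N by near: M; exact: nbhs_infty_ge.
  have [g3 [G' hq]] := trig_profileE N M.
  have [_ h] := ip_wave_diff l10 l11 l20 l21 l12 t0 hq (step_gt j).
  have e : (fun x => Q M j x - Q N j x) = fun x => (step j - t)^-1 *
      (wave gam (F N M) (step j) x - wave gam (F N M) t x).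
    by apply/funext => x; rewrite /Q -!(wave_sub _ _ _ NM); ring.
  rewrite e; apply: le_trans h _.
  by rewrite ler_wpM2l// trig_energy_le_eps.
have c := cvg_l2B mD cphit (wave_quotient_cvg_l2 N).
apply: (ler_cvg_to (cvg_l2_ip mD c c) (cvg_cst _)).
by apply: nearW => j; exact: le.
Unshelve. all: by end_near. Qed.

Lemma quad_limit (phix phit : R -> R) (wk : (R -> R)^nat) :
  (forall k, test_function (D t) (wk k)) ->
  cvg_l2 mu (D t) wk (phi ^~ t) ->
  cvg_l2 mu (D t) (fun k => derive1 (wk k)) phix ->
  cvg_l2 mu (D t) (fun j x => (step j - t)^-1 * (phi x (step j) - phi x t)) phit ->
  quad t (D t) phix phit = S.
Proof.
move=> twk cwk cdwk cphit.
have cx := wavex_cvg_l2 twk cwk cdwk; have ct := wavet_cvg_l2 cphit.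
have cxx : cvg_l2 mu (D t) (fun n x => x * wavex gam (F1 0 n) t x) (fun x => x * phix x).
  apply: (@cvg_l2M _ _ _ mu (D t) mD _ _ id (L * t)) => //.
  by move=> x; exact: Iat_norm_le.
have : quad t (D t) (wavex gam (F1 0 n) t) (wavet gam (F1 0 n) t) @[n --> \oo] -->
    quad t (D t) phix phit.
  apply: cvgD; last exact: (cvg_l2_ip mD cxx ct).
  apply: cvgM; first exact: cvg_cst.
  by apply: cvgD; [exact: (cvg_l2_ip mD cx cx)|exact: (cvg_l2_ip mD ct ct)].
have -> : (fun n => quad t (D t) (wavex gam (F1 0 n) t) (wavet gam (F1 0 n) t)) =
    trig_energy 0.
  apply/funext => n; have [f3 [G hp]] := trig_profileE 0 n.
  exact: (quad_wave_energy l10 l11 l20 l21 l12 t0 hp).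
by move=> h; exact: (cvg_unique _ h energyS).
Qed.

End convergence_of_modes.

(** * The hypotheses in terms of [cvg_l2] *)

Section L2_sqintegrable.
Context {R : realType}.
Notation mu := (@lebesgue_measure R).
Implicit Types (A : set R) (u v : R -> R).

Lemma L2_sqintegrable A u : measurable (A : set (measurableTypeR R)) ->
  L2 A u -> sqintegrable mu A u.
Proof.
move=> mA h; have := Lfun2_integrable_sqr h.
have [mu0 _] : measurable_fun setT (u \_ A : measurableTypeR R -> R) /\ True.
  by move: h; rewrite /L2 inE => /andP[+ _]; rewrite inE.
move=> iu; split; first exact/(measurable_restrictT _ mA).
apply/(integrable_mkcond _ mA); apply: eq_integrable iu => // x _.
by rewrite /= !patchE; case: ifP => //= _; rewrite expr0n.
Qed.

Lemma L2_restrict_sqintegrable A u : measurable (A : set (measurableTypeR R)) ->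
  L2 A u -> sqintegrable mu setT (u \_ A).
Proof.
move=> mA h; have iu := Lfun2_integrable_sqr h; split => //.
by move: h; rewrite /L2 inE => /andP[+ _]; rewrite inE.
Qed.

Lemma L2norm_ip A u : measurable (A : set (measurableTypeR R)) ->
  sqintegrable mu A u -> L2norm A u = (Num.sqrt (ip mu A u u))%:E.
Proof.
move=> mA [_ iu]; rewrite /L2norm unlock.
have -> : (\int[mu]_x `|(EFin \o (u \_ A)) x| `^ 2 = (ip mu A u u)%:E)%E.
  rewrite /ip /Rintegral fineK; last first.
    by apply: integrable_fin_num => //; apply: eq_integrable iu => // x _.
  rewrite [RHS]integral_mkcond; apply: eq_integral => x _.
  rewrite /= !patchE; case: ifP => _ /=.
    by rewrite powR_mulrn// real_normK ?num_real// expr2.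
  by rewrite normr0 powR0.
by rewrite poweR_EFin powR12_sqrt// ip_ge0.
Qed.

Lemma L2norm_cvg0 A (u : (R -> R)^nat) : measurable (A : set (measurableTypeR R)) ->
  (forall n, sqintegrable mu A (u n)) ->
  L2norm A (u n) @[n --> \oo] --> 0%E -> ip mu A (u n) (u n) @[n --> \oo] --> (0 : R).
Proof.
move=> mA lu; under eq_fun do rewrite L2norm_ip//.
move=> /fine_cvgP[_ /=] h.
have h2 := cvgM h h; rewrite mulr0 in h2.
rewrite (_ : (fun n => ip mu A (u n) (u n)) =
  (fun n => Num.sqrt (ip mu A (u n) (u n)) * Num.sqrt (ip mu A (u n) (u n)))).
  exact: h2.
by apply/funext => n /=; rewrite -expr2 sqr_sqrtr// ip_ge0.
Qed.

Lemma ip_subset (A B : set R) u : measurable (A : set (measurableTypeR R)) ->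
  measurable (B : set (measurableTypeR R)) -> A `<=` B -> sqintegrable mu B u ->
  ip mu A u u <= ip mu B u u.
Proof.
move=> mA mB AB lu; have iB := integrableM mB lu lu.
have iA := integrableS mB mA AB iB.
rewrite /ip /Rintegral fine_le//; try exact: integrable_fin_num.
apply: ge0_subset_integral => //; first by case/integrableP: iB.
by move=> x _; rewrite /= lee_fin -expr2 sqr_ge0.
Qed.

End L2_sqintegrable.

Section hypotheses_in_L2.
Context {R : realType}.
Notation mu := (@lebesgue_measure R).
Variables (l1 l2 : R).
Hypotheses (l10 : 0 <= l1) (l20 : 0 <= l2).
Notation D t := (Iat l1 l2 t).

Lemma test_function_continuous_on (A : set R) w a b :
  test_function A w -> continuous_on a b w /\ continuous_on a b (derive1 w).
Proof.
move=> [dw _]; split=> x _; apply/differentiable_continuous/derivable1_diffP.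
  exact: (dw 0).
exact: (dw 1).
Qed.

Lemma H10_cvg_l2 t (u v : R -> R) : H10_deriv (D t) u v ->
  exists wk : (R -> R)^nat, [/\ forall k, test_function (D t) (wk k),
    cvg_l2 mu (D t) wk u & cvg_l2 mu (D t) (fun k => derive1 (wk k)) v].
Proof.
have mD : measurable (D t : set (measurableTypeR R)) by exact: measurable_itv.
move=> [[/(L2_sqintegrable mD) lu /(L2_sqintegrable mD) lv _] [wk [twk c0 c1]]].
have lw k : sqintegrable mu (D t) (wk k).
  apply: continuous_on_sqintegrable.
  by have [] := @test_function_continuous_on _ _ (- (l1 * t)) (l2 * t) (twk k).
have lw1 k : sqintegrable mu (D t) (derive1 (wk k)).
  apply: continuous_on_sqintegrable.
  by have [] := @test_function_continuous_on _ _ (- (l1 * t)) (l2 * t) (twk k).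
exists wk; split => //; split => //.
  by apply: L2norm_cvg0 => // k; exact: sqintegrableB.
by apply: L2norm_cvg0 => // k; exact: sqintegrableB.
Qed.

(** At times after [t] the interval contains [D t], so the extensions by zero are invisible on
    [D t], and restricting the norm from the line to [D t] only decreases it. *)
Lemma L2_time_derivative_cvg_l2 t0 t (u u' : R -> R -> R) : 0 < t -> t0 <= t ->
  (forall s, t0 <= s -> L2 (D s) (u ^~ s)) -> L2 (D t) (u' ^~ t) ->
  L2_time_derivative l1 l2 t0 u u' ->
  cvg_l2 mu (D t) (fun j x => (t + j.+1%:R^-1 - t)^-1 * (u x (t + j.+1%:R^-1) - u x t))
    (u' ^~ t).
Proof.
move=> tpos t0t lu lu' du.
have mD s : measurable (D s : set (measurableTypeR R)) by exact: measurable_itv.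
pose s j : R := t + j.+1%:R^-1.
have st j : t < s j by rewrite /s ltrDl invr_gt0.
have t0s j : t0 <= s j by exact: le_trans t0t (ltW (st j)).
pose g j x : R := (s j - t)^-1 * (ext l1 l2 u (s j) x - ext l1 l2 u t x) -
  ext l1 l2 u' t x.
have mT : measurable ([set: R] : set (measurableTypeR R)) by exact: measurableT.
have lg j : sqintegrable mu setT (g j).
  apply: sqintegrableB => //; last exact: L2_restrict_sqintegrable.
  apply: sqintegrableZ => //.
  by apply: sqintegrableB => //; apply: L2_restrict_sqintegrable => //; exact: lu.
have scvg : s @ \oo --> within `[t0, +oo[ t^'.
  have sc : s @ \oo --> t.
    rewrite -[X in _ --> X]addr0; apply: cvgD; first exact: cvg_cst.
    exact: cvg_harmonic.
  move=> U hU.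
  have {}hU : nbhs t (fun x => x != t -> `[t0, +oo[%classic x -> U x) by exact: hU.
  have : \forall j \near \oo, s j != t -> `[t0, +oo[%classic (s j) -> U (s j).
    exact: (sc _ hU).
  apply: filterS => j; apply; first by rewrite gt_eqF ?st.
  by rewrite /= in_itv /= andbT.
have g0 : ip mu setT (g j) (g j) @[j --> \oo] --> (0 : R).
  apply: L2norm_cvg0 => //.
  exact: (cvg_comp _ _ scvg (du t t0t)).
have Dsub j : D t `<=` D (s j).
  move=> x; rewrite /Iat /= !in_itv /= => /andP[ax xb]; apply/andP; split.
    by apply: le_lt_trans ax; rewrite lerN2 ler_wpM2l// ltW.
  by apply: lt_le_trans xb _; rewrite ler_wpM2l// ltW.
have lt r : t <= r -> t0 <= r -> (D t `<=` D r) -> sqintegrable mu (D t) (u ^~ r).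
  move=> tr t0r Dr; have [m i] := L2_sqintegrable (mD r) (lu _ t0r); split.
    by apply: measurable_funS m; [exact: mD|exact: Dr].
  by apply: integrableS i; [exact: mD|exact: mD|exact: Dr].
have lu't := L2_sqintegrable (mD t) lu'.
have lQ j : sqintegrable mu (D t) (fun x => (s j - t)^-1 * (u x (s j) - u x t)).
  by apply: sqintegrableZ => //; apply: sqintegrableB => //; apply: lt => //; exact: ltW.
apply: (cvg_l2_le lQ lu't g0) => j.
have lQu := sqintegrableB (mD t) (lQ j) lu't.
apply: (@le_trans _ _ (ip mu (D t) (g j) (g j))).
  rewrite le_eqVlt; apply/orP; left; apply/eqP.
  have e x : D t x -> (s j - t)^-1 * (u x (s j) - u x t) - u' x t = g j x.
    by move=> Dx; rewrite /g /ext !patchE !mem_set//; exact: Dsub.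
  by apply: eq_ip.
exact: (ip_subset (mD t) mT).
Qed.

End hypotheses_in_L2.

(** * The coefficients *)

Section coefficients.
Context {R : realType}.
Variable c : int -> R[i].

Let re (n : int) : R := complex.Re (c n).
Let im (n : int) : R := complex.Im (c n).

(** Pairing the modes [k] and [- k] gives [(c_k + c_{-k}) cos + i (c_k - c_{-k}) sin]; these four
    are the coefficients of its real and imaginary parts. *)
Definition Re_cos (k : nat) : R := re k%:Z + re (- k%:Z).
Definition Re_sin (k : nat) : R := im (- k%:Z) - im k%:Z.
Definition Im_cos (k : nat) : R := im k%:Z + im (- k%:Z).
Definition Im_sin (k : nat) : R := re k%:Z - re (- k%:Z).

Lemma ReD (x y : R[i]) : complex.Re (x + y) = complex.Re x + complex.Re y.
Proof. by case: x y => ? ? []. Qed.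

Lemma ImD (x y : R[i]) : complex.Im (x + y) = complex.Im x + complex.Im y.
Proof. by case: x y => ? ? []. Qed.

Lemma modeE l1 l2 x t (n : int) (w := pi * kappa_l l1 l2)
    (y1 := ln (t + x)) (y2 := delay l2 + ln (t - x)) :
  mode l1 l2 c x t n =
  ((re n * (cos (n%:~R * (w * y1)) - cos (n%:~R * (w * y2))) -
    im n * (sin (n%:~R * (w * y1)) - sin (n%:~R * (w * y2)))) +i*
   (re n * (sin (n%:~R * (w * y1)) - sin (n%:~R * (w * y2))) +
    im n * (cos (n%:~R * (w * y1)) - cos (n%:~R * (w * y2)))))%C.
Proof.
have -> : n%:~R * (w * y2) = n%:~R * pi * kappa_l l1 l2 * ln ((1 + l2) / (1 - l2)) +
    n%:~R * pi * kappa_l l1 l2 * ln (t - x) by rewrite /w /y2 /delay; ring.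
have -> : n%:~R * (w * y1) = n%:~R * pi * kappa_l l1 l2 * ln (t + x).
  by rewrite /w /y1; ring.
rewrite /mode /re /im; case: (c n) => u v /=.
rewrite /cis cosD sinD; simpc.
by congr (_ +i* _)%C; ring.
Qed.

Lemma mode_sum l1 l2 x t (k : nat) (w := pi * kappa_l l1 l2)
    (y1 := ln (t + x)) (y2 := delay l2 + ln (t - x)) :
  complex.Re (mode l1 l2 c x t k%:Z + mode l1 l2 c x t (- k%:Z)) =
    (Re_cos k * cos (k%:R * (w * y1)) + Re_sin k * sin (k%:R * (w * y1))) -
    (Re_cos k * cos (k%:R * (w * y2)) + Re_sin k * sin (k%:R * (w * y2))) /\
  complex.Im (mode l1 l2 c x t k%:Z + mode l1 l2 c x t (- k%:Z)) =
    (Im_cos k * cos (k%:R * (w * y1)) + Im_sin k * sin (k%:R * (w * y1))) -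
    (Im_cos k * cos (k%:R * (w * y2)) + Im_sin k * sin (k%:R * (w * y2))).
Proof.
rewrite !modeE ReD ImD /= !rmorphN /= -!pmulrn !mulNr !cosN !sinN.
by rewrite /Re_cos /Re_sin /Im_cos /Im_sin; split; ring.
Qed.

Lemma partial_sumE l1 l2 x t N (w := pi * kappa_l l1 l2) :
  complex.Re (partial_sum l1 l2 c x t N) =
    wave (delay l2) (trig w Re_cos Re_sin 0 N) t x /\
  complex.Im (partial_sum l1 l2 c x t N) =
    wave (delay l2) (trig w Im_cos Im_sin 0 N) t x.
Proof.
rewrite !waveE /trig -!sumrB /partial_sum; split.
  rewrite (big_morph _ ReD (erefl (complex.Re (0 : R[i])))).
  by apply: eq_bigr => k _; rewrite (mode_sum l1 l2 x t k).1.
rewrite (big_morph _ ImD (erefl (complex.Im (0 : R[i])))).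
by apply: eq_bigr => k _; rewrite (mode_sum l1 l2 x t k).2.
Qed.

Let sq (n : int) : R := complex.Re `|n%:~R * c n| ^+ 2.

Lemma norm_coefE n : sq n = n%:~R ^+ 2 * (re n ^+ 2 + im n ^+ 2).
Proof.
rewrite /sq /re /im -(rmorph_int (real_complex R)); case: (c n) => u v.
rewrite normc_def /= sqr_sqrtr ?addr_ge0 ?sqr_ge0//; ring.
Qed.

Lemma sq_ge0 n : 0 <= sq n.
Proof. exact: sqr_ge0. Qed.

Lemma sum_ncn2E : (sum_ncn2 c = \sum_(k <oo | (0 < k)%N) (sq k%:Z + sq (- k%:Z))%:E)%E.
Proof.
rewrite /sum_ncn2 (esumID [set n : int | 0 < n]); last first.
  by move=> n _; rewrite lee_fin sqr_ge0.
rewrite nneseries_esum; last by move=> n _; rewrite lee_fin addr_ge0 ?sq_ge0.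
under [RHS]eq_esum do rewrite EFinD.
rewrite [RHS]esumD; last 2 first.
- by move=> n _; rewrite lee_fin sq_ge0.
- by move=> n _; rewrite lee_fin sq_ge0.
congr (_ + _)%E.
  apply: (@reindex_esum R _ _ _ _ Posz); split.
  - by move=> k /= k0; rewrite !ltz_nat; split => //; case: k k0.
  - by move=> i j _ _ [].
  - by move=> [k|k] [//= k0 k1]; exists k.
apply: (@reindex_esum R _ _ _ _ (fun k : nat => - Posz k)); split.
- by move=> k /= k0; rewrite oppr_eq0; split; [case: k k0|case: k k0].
- by move=> i j _ _ /oppr_inj [].
- by move=> [k|k] [//= k0 k1]; [case: k k0 k1|exists k.+1].
Qed.

Lemma sum_ncn2_cvg : (sum_ncn2 c < +oo)%E ->
  \sum_(1 <= k < n.+1) (sq k%:Z + sq (- k%:Z)) @[n --> \oo] --> fine (sum_ncn2 c).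
Proof.
move=> fin.
have h : (fun n => (\sum_(1 <= k < n.+1) (sq k%:Z + sq (- k%:Z)))%:E) @ \oo -->
    sum_ncn2 c.
  rewrite sum_ncn2E.
  have /cvg_ex[l hl] : cvgn (fun n => (\sum_(0 <= k < n | (0 < k)%N)
      (sq k%:Z + sq (- k%:Z))%:E)%E).
    by apply: is_cvg_nneseries => n _ _; rewrite lee_fin addr_ge0 ?sq_ge0.
  have -> := cvg_lim _ hl; last exact: ereal_hausdorff.
  (* The shift by one aligns the ranges: the sum over [k < n.+1] without its term [k = 0] runs from
     1 to [n]. *)
  have := hl; rewrite -(cvg_shiftS _) /=; apply: cvg_trans.
  apply: near_eq_cvg; apply: nearW => n /=.
  by rewrite -sumEFin big_mkcond big_nat_recl//= add0e big_add1.
have fn : sum_ncn2 c \is a fin_num.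
  by rewrite ge0_fin_numE//; apply: esum_ge0 => n _; rewrite lee_fin sqr_ge0.
by rewrite -(fineK fn) in h; have /fine_cvgP[_] := h.
Qed.

(** Parallelogram identity for [c_k + c_{-k}] and [c_k - c_{-k}]. It produces the factor 2 in
    [S_l]. *)
Lemma coef_energy (k : nat) : (Re_cos k ^+ 2 + Re_sin k ^+ 2) +
  (Im_cos k ^+ 2 + Im_sin k ^+ 2) =
  2 * (re k%:Z ^+ 2 + im k%:Z ^+ 2) + 2 * (re (- k%:Z) ^+ 2 + im (- k%:Z) ^+ 2).
Proof. by rewrite /Re_cos /Re_sin /Im_cos /Im_sin; ring. Qed.

End coefficients.

(** * Conclusion *)

Section conclusion.
Context {R : realType}.
Notation mu := (@lebesgue_measure R).
Variables (l1 l2 : R) (c : int -> R[i]).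
Hypotheses (l10 : 0 <= l1) (l11 : l1 < 1) (l20 : 0 <= l2) (l21 : l2 < 1)
  (l12 : 0 < l1 + l2).
Hypothesis cfin : (sum_ncn2 c < +oo)%E.
Notation D t := (Iat l1 l2 t).
Let w : R := pi * kappa_l l1 l2.

Let P0 : 0 < period l1 l2 := period_gt0 l10 l11 l20 l21 l12.

Let kappaE : kappa_l l1 l2 = 2 / period l1 l2.
Proof. by []. Qed.

Let w0 : 0 < w.
Proof. by rewrite /w kappaE mulr_gt0 ?pi_gt0// divr_gt0. Qed.

Let wE : 2 * pi / w = period l1 l2.
Proof.
rewrite /w kappaE; move: (pi_gt0 R); move: (pi : R) => z z0.
by field; rewrite !gt_eqF.
Qed.

Let eRe := trig_energy l1 l2 w (Re_cos c) (Re_sin c) 0.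
Let eIm := trig_energy l1 l2 w (Im_cos c) (Im_sin c) 0.

Let total_cvg : eRe n + eIm n @[n --> \oo] --> S_l l1 l2 c.
Proof.
have -> : (fun n => eRe n + eIm n) = (fun n => 2 * pi ^+ 2 * kappa_l l1 l2 *
    \sum_(1 <= k < n.+1) (complex.Re `|(k%:Z)%:~R * c k%:Z| ^+ 2 +
      complex.Re `|(- k%:Z)%:~R * c (- k%:Z)| ^+ 2)).
  apply/funext => n; rewrite /eRe /eIm /trig_energy -mulrDr -big_split /=.
  rewrite !mulr_sumr; apply: eq_bigr => k _.
  have := coef_energy c k; rewrite !norm_coefE /dcos /dsin.
  rewrite rmorphN /= -pmulrn sqrrN.
  set A := complex.Re _ ^+ 2 + _; set B := complex.Re _ ^+ 2 + _ => h.
  transitivity (period l1 l2 / 2 * w ^+ 2 * k%:R ^+ 2 * (2 * A + 2 * B)).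
    by rewrite -h; ring.
  (* Half the period is [1 / kappa_l] and [w = pi * kappa_l]: this is the origin of the constant in
     [S_l]. *)
  have -> : period l1 l2 / 2 * w ^+ 2 = pi ^+ 2 * kappa_l l1 l2.
    by rewrite /w kappaE; move: (pi : R) => z; field; rewrite gt_eqF.
  by ring.
by apply: cvgM; [exact: cvg_cst|exact: sum_ncn2_cvg].
Qed.

(** Only the sum of the two energies is known to converge so far. Each is nondecreasing and bounded
    by the limit of the sum, so each has its own limit, as [quad_limit] requires. *)
Let energies : exists SRe SIm, [/\ eRe @ \oo --> SRe, eIm @ \oo --> SIm &
  SRe + SIm = S_l l1 l2 c].
Proof.
have nd p q := trig_energy_nondecreasing l10 l11 l20 l21 l12 p q w0 wE.
have ge p q := trig_energy_ge0 l10 l11 l20 l21 l12 p q w0 wE.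
have le n : eRe n + eIm n <= S_l l1 l2 c.
  have ct : cvgn (fun n => eRe n + eIm n) by apply/cvg_ex; exists (S_l l1 l2 c).
  rewrite -(cvg_lim (@Rhausdorff R) total_cvg).
  by apply: nondecreasing_cvgn_le => // i j ij; apply: lerD; exact: nd.
have cRe : cvgn eRe.
  apply: nondecreasing_is_cvgn; first exact: nd.
  exists (S_l l1 l2 c) => _ [n _ <-].
  by apply: le_trans (le n); rewrite lerDl; exact: ge.
have cIm : cvgn eIm.
  apply: nondecreasing_is_cvgn; first exact: nd.
  exists (S_l l1 l2 c) => _ [n _ <-].
  by apply: le_trans (le n); rewrite lerDr; exact: ge.
exists (limn eRe), (limn eIm); split => //.
exact: (cvg_unique (@Rhausdorff R) (cvgD cRe cIm) total_cvg).
Qed.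

Lemma test_function_cst0 t : test_function (D t) (cst 0 : R -> R).
Proof.
have h n : derive1n n (cst 0 : R -> R) = cst 0.
  by elim: n => [//|n IH]; rewrite derive1nS IH; apply/funext => x; exact: derive1_cst.
split=> [n x|]; first by rewrite h; exact: derivable_cst.
by exists set0; split => //; exact: compact0.
Qed.

(* The imaginary part of the series represents the zero solution, so
   [quad_limit] shows that its energy vanishes: the real part carries [S_l]. *)
Lemma quad_series (t0 t : R) (phi phix phit : R -> R -> R) :
  0 < t0 -> t0 <= t ->
  (forall s, t0 <= s -> H10_deriv (D s) (phi ^~ s) (phix ^~ s)) ->
  L2 (D t) (phit ^~ t) -> L2_time_derivative l1 l2 t0 phi phit ->
  series_coefficients l1 l2 t0 phi c ->
  quad t (D t) (phix ^~ t) (phit ^~ t) = S_l l1 l2 c.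
Proof.
move=> t00 t0t hphi lphit dphi [_ ser].
have tpos : 0 < t by exact: lt_le_trans t0t.
have mD s : measurable (D s : set (measurableTypeR R)) by exact: measurable_itv.
have L2phi s : t0 <= s -> L2 (D s) (phi ^~ s) by move=> /hphi[[]].
have [SRe [SIm [cRe cIm <-]]] := energies.
have [wk [twk cwk cdwk]] := H10_cvg_l2 (hphi t t0t).
have ct := L2_time_derivative_cvg_l2 l10 l20 tpos t0t L2phi lphit dphi.
have -> : quad t (D t) (phix ^~ t) (phit ^~ t) = SRe.
  apply: (quad_limit l10 l11 l20 l21 l12 w0 wE cRe tpos _ _ twk cwk cdwk ct).
    by move=> s ts; apply: L2_sqintegrable => //; apply: L2phi; exact: le_trans ts.
  move=> s ts; have [N [mN N0 NP]] := ser s (le_trans t0t ts).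
  exists N; split => //; apply: subset_trans NP; apply: subsetC => x h Dx.
  rewrite (_ : (fun n => _) = (fun n => complex.Re (partial_sum l1 l2 c x s n))).
    exact: (h Dx).1.
  by apply/funext => n; rewrite (partial_sumE c l1 l2 x s n).1.
suff -> : SIm = 0 by rewrite addr0.
have zero : sqintegrable mu (D t) (fun=> 0 : R).
  by apply: (@continuous_on_sqintegrable _ (- (l1 * t)) (l2 * t)) => x _; exact: cvg_cst.
have cz := cvg_l2_cst (mD t) zero.
rewrite -(@quad_limit R l1 l2 l10 l11 l20 l21 l12 w _ _ w0 wE SIm cIm t
  (fun _ _ => 0) tpos _ _ (fun=> 0) (fun=> 0) (fun _ => cst 0)).
- have i0 (u : R -> R) : ip mu (D t) u (fun=> 0) = 0.
    rewrite /ip; under eq_Rintegral do rewrite mulr0.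
    by rewrite Rintegral_cst// mul0r.
  by rewrite /quad !i0 !addr0 mulr0.
- move=> s _; apply: (@continuous_on_sqintegrable _ (- (l1 * s)) (l2 * s)) => x _.
  exact: cvg_cst.
- move=> s ts; have [N [mN N0 NP]] := ser s (le_trans t0t ts).
  exists N; split => //; apply: subset_trans NP; apply: subsetC => x h Dx.
  rewrite (_ : (fun n => _) = (fun n => complex.Im (partial_sum l1 l2 c x s n))).
    exact: (h Dx).2.
  by apply/funext => n; rewrite (partial_sumE c l1 l2 x s n).2.
- by move=> k; exact: test_function_cst0.
- exact: cz.
- rewrite (_ : (fun _ => derive1 _) = (fun _ _ => 0)); first exact: cz.
  by apply/funext => k; apply/funext => x; exact: derive1_cst.
- rewrite (_ : (fun _ _ => _) = (fun _ _ => 0)); first exact: cz.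
  by apply/funext => k; apply/funext => x; rewrite subrr mulr0.
Qed.

End conclusion.
Unset Implicit Arguments.

Theorem theorem2 (R : realType) (l1 l2 L0 : R) (phi0 phi1 : R -> R)
    (phi phix phit : R -> R -> R) (c : int -> R[i]) :
  0 <= l1 -> l1 < 1 -> 0 <= l2 -> l2 < 1 -> 0 < l1 + l2 -> 0 < L0 ->
  let t0 := L0 / (l1 + l2) in
  H10 (Iat l1 l2 t0) phi0 ->
  L2 (Iat l1 l2 t0) phi1 ->
  WP_solution l1 l2 t0 phi0 phi1 phi phix phit ->
  series_coefficients l1 l2 t0 phi c ->
  (forall t, t0 <= t ->
     t * energy l1 l2 phix phit t
     + \int[@lebesgue_measure R]_(x in Iat l1 l2 t)
         (x * phix x t * phit x t)
     = S_l l1 l2 c) /\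
  (forall t, t0 <= t ->
     S_l l1 l2 c / (t * (1 + L_l l1 l2)) <= energy l1 l2 phix phit t
       <= S_l l1 l2 c / (t * (1 - L_l l1 l2))).
Proof.
move=> l10 l11 l20 l21 l12 L00 t0 _ _ sol ser.
have t00 : 0 < t0 by exact: divr_gt0.
have mD t : measurable (Iat l1 l2 t : set (measurableTypeR R)) by exact: measurable_itv.
have Q t (t0t : t0 <= t) := quad_series l10 l11 l20 l21 l12 ser.1 t00 t0t
  (WP_H10 sol) (WP_L2 sol t0t) (WP_phit sol) ser.
have lx t : t0 <= t -> sqintegrable (@lebesgue_measure R) (Iat l1 l2 t) (phix ^~ t).
  by move=> t0t; apply: L2_sqintegrable => //; have [[]] := WP_H10 sol t0t.
have lt t : t0 <= t -> sqintegrable (@lebesgue_measure R) (Iat l1 l2 t) (phit ^~ t).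
  by move=> t0t; apply: L2_sqintegrable => //; exact: (WP_L2 sol t0t).
have E t : t0 <= t -> ip (@lebesgue_measure R) (Iat l1 l2 t) (phix ^~ t) (phix ^~ t) +
    ip (@lebesgue_measure R) (Iat l1 l2 t) (phit ^~ t) (phit ^~ t) =
    2 * energy l1 l2 phix phit t.
  move=> t0t; rewrite /energy mulrA divff// mul1r /ip -RintegralD//.
  - by apply: integrableM => //; exact: lx.
  - by apply: integrableM => //; exact: lt.
split=> t t0t; have tpos : 0 < t by exact: lt_le_trans t0t.
  rewrite -(Q t t0t) /quad E//; congr (_ + _).
  by move: (energy _ _ _ _ _) => z; field.
have L0' : 0 <= L_l l1 l2 by rewrite le_max l10.
have L1 : L_l l1 l2 < 1 by rewrite gt_max l11.
(* Since [quad] equals [S_l] and the two squared norms add up to [2 E], the comparison reads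
   [t (1 - L) E <= S_l <= t (1 + L) E]. *)
have := quad_lower tpos (lx t t0t) (lt t t0t).
have := quad_upper tpos (lx t t0t) (lt t t0t).
rewrite Q// E// => h1 h2; apply/andP; split.
  by rewrite ler_pdivrMr; [move: h1; lra|rewrite mulr_gt0//; lra].
by rewrite ler_pdivlMr; [move: h2; lra|rewrite mulr_gt0//; lra].
Qed.
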